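(* Let $\mathcal{X}$ be a finite set, $\mathcal{H}$ a finite-dimensional Hilbert space, $W:\mathcal{X}\to\mathcal{S}(\mathcal{H})$ a classical-quantum channel, and $p\in\mathcal{P}(\mathcal{X})$. Then for every $\epsilon\in(0,1)$, \[ R(p,W)=R_\epsilon(p,W)=\inf_{q\in\mathcal{P}(\mathcal{X}):\,W(q)=W(p)} I(X;B)_{W\times q}. \] Moreover, for every $R<R(p,W)$, $\varepsilon(p^{\otimes n},W^{\otimes n},\lfloor 2^{nR}\rfloor)\to 1$ exponentially as $n\to\infty$.
   Context: $\mathcal{S}(\mathcal{H})$ is the set of density matrices on $\mathcal{H}$ and $\mathcal{P}(\mathcal{X})$ the set of probability distributions on $\mathcal{X}$. For $q\in\mathcal{P}(\mathcal{X})$, $W(q):=\sum_x q(x)W_x$ and $I(X;B)_{W\times q}:=\sum_x q(x)D(W_x\|W(q))$ with $D(\rho\|\sigma)=\mathrm{Tr}\,\rho(\log\rho-\log\sigma)$; logarithms are base 2. For $x^n\in\mathcal{X}^n$, $W^{\otimes n}_{x^n}:=W_{x_1}\otimes\cdots\otimes W_{x_n}$, and for a distribution $p^n$ on $\mathcal{X}^n$, $W^{\otimes n}(p^n):=\sum_{x^n}p^n(x^n)W^{\otimes n}_{x^n}$; $p^{\otimes n}$ is the i.i.d. product distribution. For a positive integer $M$, $\mathcal{P}_M(\mathcal{X}^n)$ is the set of distributions $q$ on $\mathcal{X}^n$ with $Mq(x^n)\in\mathbb{Z}$ for all $x^n$ (equivalently, empirical distributions of codebooks of $M$ codewords). Define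 \[ \varepsilon(p^{\otimes n},W^{\otimes n},M):=\inf_{q^n\in\mathcal{P}_M(\mathcal{X}^n)}\tfrac12\|W^{\otimes n}(p^{\otimes n})-W^{\otimes n}(q^n)\|_1, \] $R(p,W):=\inf\{R>0:\ \forall\gamma>0,\ \liminf_{n\to\infty}\varepsilon(p^{\otimes n},W^{\otimes n},\lfloor 2^{n(R+\gamma)}\rfloor)=0\}$, and for $\epsilon\in(0,1)$, $M_\epsilon(p^{\otimes n},W^{\otimes n}):=\min\{M\in\mathbb{N}_+:\varepsilon(p^{\otimes n},W^{\otimes n},M)\le\epsilon\}$ and $R_\epsilon(p,W):=\liminf_{n\to\infty}\frac1n\log M_\epsilon(p^{\otimes n},W^{\otimes n})$. *)

(* Defs.v *)
From HB Require Import structures.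
From mathcomp Require Import all_boot all_order all_algebra.
From mathcomp Require Import spectral sesquilinear.
From mathcomp Require Import complex.
From mathcomp Require Import boolp classical_sets reals ereal topology normedtype sequences exp.

Set Implicit Arguments.
Unset Strict Implicit.
Unset Printing Implicit Defensive.

Import Order.TTheory GRing.Theory Num.Theory.
Local Open Scope ring_scope.

Section QDefs.
Variable R : realType.
Local Notation C := R[i].

Definition toC (r : R) : C := Complex r 0.

Definition log2 (x : R) : R := ln x / ln 2.

Definition is_dist (T : finType) (q : T -> R) : Prop :=
  (forall t, 0 <= q t) /\ \sum_t q t = 1.

Definition is_psd d (A : 'M[C]_d) : Prop :=
  forall v : 'rV[C]_d, 0 <= (v *m A *m map_mx Num.conj v^T) 0 0.
Definition is_state d (A : 'M[C]_d) : Prop :=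
  A \is hermsymmx /\ is_psd A /\ \tr A = 1.

(* functional calculus f(A) for a normal (here: Hermitian) matrix A, applying the
   real function f to the (real) eigenvalues: A = U^* diag(l) U  ==>
   f(A) = U^* diag(f(l)) U  (spectral decomposition from spectral.v) *)
Definition mxfun (f : R -> R) d (A : 'M[C]_d) : 'M[C]_d :=
  map_mx Num.conj (spectralmx A)^T
    *m diag_mx (map_mx (fun z : C => toC (f (complex.Re z))) (spectral_diag A))
    *m spectralmx A.

(* matrix logarithm (base 2) on the support, with the usual 0 log 0 = 0 convention *)
Definition mxlog2 d (A : 'M[C]_d) : 'M[C]_d :=
  mxfun (fun x => if 0 < x then log2 x else 0) A.

Definition trnorm d (A : 'M[C]_d) : R :=
  complex.Re (\tr (mxfun Num.sqrt (map_mx Num.conj A^T *m A))).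

(* quantum relative entropy D(rho||sigma) = Tr rho (log rho - log sigma) (base 2),
   equal to +oo when supp rho is not contained in supp sigma *)
Definition relent d (rho sigma : 'M[C]_d) : \bar R :=
  if `[< forall v : 'rV[C]_d, v *m sigma = 0 -> v *m rho = 0 >]
  then (complex.Re (\tr (rho *m (mxlog2 rho - mxlog2 sigma))))%:E
  else +oo%E.

Definition Wmix (X : finType) d (W : X -> 'M[C]_d) (q : X -> R) : 'M[C]_d :=
  \sum_x toC (q x) *: W x.

(* I(X;B)_{W x q} = sum_x q(x) D(W_x || W(q))  (with 0 * (+oo) = 0) *)
Definition mutinf (X : finType) d (W : X -> 'M[C]_d) (q : X -> R) : \bar R :=
  (\sum_x (q x)%:E * relent (W x) (Wmix W q))%E.

(* n-fold tensor power space: basis indexed by sequences {ffun 'I_n -> 'I_d}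
   (product basis); tensor product of n matrices A_0 (x) ... (x) A_{n-1} *)
Definition tdim n d := #|{ffun 'I_n -> 'I_d}|.
Definition tidx n d (i : 'I_(tdim n d)) : {ffun 'I_n -> 'I_d} := enum_val i.
Definition tensmxn n d (A : 'I_n -> 'M[C]_d) : 'M[C]_(tdim n d) :=
  \matrix_(i, j) \prod_(k < n) A k (tidx i k) (tidx j k).

Definition Wn (X : finType) d (W : X -> 'M[C]_d) n (xn : {ffun 'I_n -> X}) :
  'M[C]_(tdim n d) := tensmxn (fun k => W (xn k)).

Definition Wnmix (X : finType) d (W : X -> 'M[C]_d) n (pn : {ffun 'I_n -> X} -> R) :
  'M[C]_(tdim n d) := \sum_xn toC (pn xn) *: Wn W xn.

Definition iid (X : finType) (p : X -> R) n (xn : {ffun 'I_n -> X}) : R :=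
  \prod_(k < n) p (xn k).

Definition PM (X : finType) n (M : nat) (q : {ffun 'I_n -> X} -> R) : Prop :=
  is_dist q /\ forall xn, exists k : nat, M%:R * q xn = k%:R.

Definition epsn (X : finType) d (W : X -> 'M[C]_d) (p : X -> R) n (M : nat) : R :=
  inf [set (trnorm (Wnmix W (@iid X p n) - Wnmix W q)) / 2 | q in @PM X n M].

Definition Rsoft (X : finType) d (W : X -> 'M[C]_d) (p : X -> R) : \bar R :=
  ereal_inf [set r%:E | r in [set r : R | 0 < r /\
     forall g : R, 0 < g ->
       limn_einf (fun n : nat =>
         (epsn W p n (Num.truncn (2 `^ (n%:R * (r + g)))))%:E) = 0%E]].

(* M_eps(p^n, W^n) = min { M >= 1 : epsilon(p^n,W^n,M) <= eps }
   (0 if the set were empty, which does not happen) *)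
Definition Mset (X : finType) d (W : X -> 'M[C]_d) (p : X -> R) (e : R) n : pred nat :=
  fun M => (0 < M)%N && `[< epsn W p n M <= e >].
Definition Meps (X : finType) d (W : X -> 'M[C]_d) (p : X -> R) (e : R) n : nat :=
  match pselect (exists M, Mset W p e n M) with
  | left h => ex_minn h
  | right _ => 0%N
  end.

Definition Reps (X : finType) d (W : X -> 'M[C]_d) (p : X -> R) (e : R) : \bar R :=
  limn_einf (fun n : nat => (log2 (Meps W p e n)%:R / n%:R)%:E).

Definition Iinf (X : finType) d (W : X -> 'M[C]_d) (p : X -> R) : \bar R :=
  ereal_inf [set mutinf W q | q in [set q : X -> R | is_dist q /\ Wmix W q = Wmix W p]].

End QDefs.

(* Main.v *)
Require Import Defs.
From HB Require Import structures.
From mathcomp Require Import all_boot all_order all_algebra.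
From mathcomp Require Import spectral sesquilinear.
From mathcomp Require Import complex.
From mathcomp Require Import boolp classical_sets reals ereal topology normedtype sequences exp.
From mathcomp Require Import ring lra.
Import Order.TTheory GRing.Theory Num.Theory numFieldNormedType.Exports.
Local Open Scope classical_set_scope.
Local Open Scope ring_scope.
Set Implicit Arguments.
Unset Strict Implicit.
Unset Printing Implicit Defensive.

(** Write [H] for von Neumann entropy and [rho = W(p)]. On the feasible set
    [W(q) = rho] the mutual information is [H(rho) - \sum_x q(x) H(W_x)], which is
    affine in [q].

    Achievability: for feasible [q] the target is also the i.i.d. mixture under [q].
    Discard the large eigenvalues of every codeword state and the small eigenvalues
    of [rho^n]; the remaining error lives on a space of dimension about
    [2^(n H(rho))] and its Hilbert-Schmidt norm is controlled by the variance of a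
    codebook of size [M], so it vanishes once [M] exceeds [2^(n I)].

    Converse: by linear programming duality there is a Hermitian [L] with
    [Tr W_x L >= H(W_x)] for all [x] and [Tr rho L < H(rho) - r] whenever [r] is below
    the optimum. Codewords of large total entropy are told apart from [rho^n] by
    measuring the sum of the copies of [L]; those of small total entropy live, up to
    exponentially small weight, in a space too small to carry [rho^n]. Chernoff
    bounds make all errors exponentially small. *)

(** * Traces, contractions and the trace norm *)

Section LinearAlgebra.
Variable R : realType.
Local Notation C := R[i].
Local Notation Re := (@complex.Re R).

(** The states [W x] and [rho] need not commute, so both directions work with linear functionals:
    the trace norm of [A] is the maximum of [rtr (K *m A)] over contractions [K], and such traces
    are bounded by a quadratic inequality with a free parameter ([amgm]), which serves both as
    Cauchy-Schwarz and as the gentle measurement lemma. In achievability the optimal [K] depends on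
    the codebook; hence the codebook is chosen to keep small a scalar cost in which [K] does not
    occur. This cost adds the two tails to the squared Hilbert-Schmidt norm of the deviation, so
    that one greedy choice controls all of them. In the converse a codebook need not average to
    [rho], so the constrained optimum says nothing about it directly; the dual operator replaces the
    constraint by an inequality that holds letter by letter and hence for every word. Entropies are
    in nats; [ln 2] enters only through the base-2 quantities of the statement. *)

Definition adj m n (A : 'M[C]_(m, n)) : 'M[C]_(n, m) := map_mx Num.conj A^T.

Lemma ReD (x y : C) : Re (x + y) = Re x + Re y.
Proof. by case: x; case: y. Qed.

Lemma ReN (x : C) : Re (- x) = - Re x.
Proof. by case: x. Qed.

Lemma Re_sum (I : Type) (r : seq I) (P : pred I) (F : I -> C) :
  Re (\sum_(i <- r | P i) F i) = \sum_(i <- r | P i) Re (F i).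
Proof. by apply: (big_morph Re ReD). Qed.

Lemma ReZ (a : R) (z : C) : Re (toC a * z) = a * Re z.
Proof. by case: z => x y /=; rewrite mul0r subr0. Qed.

Lemma Re_conj (z : C) : Re (Num.conj z) = Re z.
Proof. by case: z. Qed.

Lemma conj_toC (a : R) : Num.conj (toC a) = toC a.
Proof. by rewrite /Num.conj /= /toC oppr0. Qed.

Lemma toCD (a b : R) : toC (a + b) = toC a + toC b.
Proof. exact: (rmorphD (real_complex R)). Qed.

Lemma toCM (a b : R) : toC (a * b) = toC a * toC b.
Proof. exact: (rmorphM (real_complex R)). Qed.

Lemma toC1 : toC (1 : R) = 1.
Proof. by []. Qed.

Lemma toC0 : toC (0 : R) = 0.
Proof. by []. Qed.

Lemma toCN (a : R) : toC (- a) = - toC a.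
Proof. exact: (rmorphN (real_complex R)). Qed.

Lemma toC_prod (I : Type) (r : seq I) (P : pred I) (F : I -> R) :
  toC (\prod_(i <- r | P i) F i) = \prod_(i <- r | P i) toC (F i).
Proof. by rewrite (big_morph _ toCM toC1). Qed.

Lemma toC_sum (I : Type) (r : seq I) (P : pred I) (F : I -> R) :
  toC (\sum_(i <- r | P i) F i) = \sum_(i <- r | P i) toC (F i).
Proof. by rewrite (big_morph _ toCD toC0). Qed.

Lemma adjK m n (A : 'M[C]_(m, n)) : adj (adj A) = A.
Proof. exact: trmxCK. Qed.

Lemma adjM m n p (A : 'M[C]_(m, n)) (B : 'M[C]_(n, p)) :
  adj (A *m B) = adj B *m adj A.
Proof. by rewrite /adj trmx_mul map_mxM. Qed.

Lemma adjD m n (A B : 'M[C]_(m, n)) : adj (A + B) = adj A + adj B.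
Proof. by rewrite /adj linearD map_mxD. Qed.

Lemma adjN m n (A : 'M[C]_(m, n)) : adj (- A) = - adj A.
Proof. by rewrite /adj linearN map_mxN. Qed.

Lemma adjZ m n (a : R) (A : 'M[C]_(m, n)) : adj (toC a *: A) = toC a *: adj A.
Proof. by rewrite /adj linearZ map_mxZ; congr (_ *: _); exact: conj_toC. Qed.

Lemma adj1 n : adj (1%:M : 'M[C]_n) = 1%:M.
Proof. by rewrite /adj trmx1 map_mx1. Qed.

Lemma adj0 m n : adj (0 : 'M[C]_(m, n)) = 0.
Proof. by rewrite /adj trmx0 map_mx0. Qed.

Lemma adj_sum m n (I : Type) (r : seq I) (P : pred I) (F : I -> 'M[C]_(m, n)) :
  adj (\sum_(i <- r | P i) F i) = \sum_(i <- r | P i) adj (F i).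
Proof. by rewrite (big_morph _ (@adjD m n) (adj0 _ _)). Qed.

Definition rtr n (A : 'M[C]_n) : R := Re (\tr A).

Lemma rtrD n (A B : 'M[C]_n) : rtr (A + B) = rtr A + rtr B.
Proof. by rewrite /rtr mxtraceD ReD. Qed.

Lemma rtrN n (A : 'M[C]_n) : rtr (- A) = - rtr A.
Proof. by rewrite /rtr raddfN ReN. Qed.

Lemma rtrB n (A B : 'M[C]_n) : rtr (A - B) = rtr A - rtr B.
Proof. by rewrite rtrD rtrN. Qed.

Lemma rtrZ n (a : R) (A : 'M[C]_n) : rtr (toC a *: A) = a * rtr A.
Proof. by rewrite /rtr mxtraceZ ReZ. Qed.

Lemma rtr0 n : rtr (0 : 'M[C]_n) = 0.
Proof. by rewrite /rtr mxtrace0. Qed.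

Lemma rtr_id n : rtr (1%:M : 'M[C]_n) = n%:R.
Proof.
rewrite /rtr mxtrace1; elim: n => // n IH.
by rewrite -!natr1 ReD IH.
Qed.

Lemma rtr_sum n (I : Type) (r : seq I) (P : pred I) (F : I -> 'M[C]_n) :
  rtr (\sum_(i <- r | P i) F i) = \sum_(i <- r | P i) rtr (F i).
Proof. by rewrite (big_morph _ (@rtrD n) (@rtr0 n)). Qed.

Lemma rtrC m n (A : 'M[C]_(m, n)) (B : 'M[C]_(n, m)) : rtr (A *m B) = rtr (B *m A).
Proof. by rewrite /rtr mxtrace_mulC. Qed.

Lemma rtr_adj n (A : 'M[C]_n) : rtr (adj A) = rtr A.
Proof.
rewrite /rtr /mxtrace !Re_sum; apply: eq_bigr => i _.
by rewrite !mxE Re_conj.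
Qed.

Lemma rtr_adjM_ge0 m n (A : 'M[C]_(m, n)) : 0 <= rtr (adj A *m A).
Proof.
rewrite /rtr Re_sum; apply: sumr_ge0 => i _; rewrite mxE Re_sum.
apply: sumr_ge0 => j _; rewrite !mxE mulrC.
by have := mulcJ_ge0 (A j i); rewrite lecE => /andP[].
Qed.

Lemma rtr_adjM_eq0 m n (A : 'M[C]_(m, n)) : rtr (adj A *m A) = 0 -> A = 0.
Proof.
have nn (z : C) : Re (Num.conj z * z) = Re z ^+ 2 + complex.Im z ^+ 2.
  by case: z => a b /=; rewrite mulNr opprK !expr2.
have nn0 (z : C) : 0 <= Re (Num.conj z * z) by rewrite nn addr_ge0 // sqr_ge0.
rewrite /rtr Re_sum => /eqP; rewrite psumr_eq0; last first.
  move=> i _; rewrite mxE Re_sum; apply: sumr_ge0 => j _; rewrite !mxE; exact: nn0.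
move=> /allP h; apply/matrixP => j i; rewrite mxE.
have := h i (mem_index_enum _); rewrite mxE Re_sum psumr_eq0; last first.
  by move=> k _; rewrite !mxE; exact: nn0.
move=> /allP /(_ j (mem_index_enum _)); rewrite !mxE nn.
rewrite paddr_eq0 ?sqr_ge0 // !sqrf_eq0 => /andP[/eqP a0 /eqP b0].
by case: (A j i) a0 b0 => a b /= -> ->.
Qed.

(** Expand the nonnegative squared norm of [t adj A - B]. The free [t] is tuned at each use, in
    place of the square roots of Cauchy-Schwarz. *)
Lemma amgm m n (A : 'M[C]_(m, n)) (B : 'M[C]_(n, m)) (t : R) :
  2 * t * rtr (A *m B) <= t ^+ 2 * rtr (A *m adj A) + rtr (adj B *m B).
Proof.
have := rtr_adjM_ge0 (toC t *: adj A - B).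
rewrite adjD adjN adjZ adjK mulmxDl !mulmxDr !rtrD !mulmxN !mulNmx !rtrN opprK.
rewrite -!scalemxAl -!scalemxAr !rtrZ.
have -> : rtr (adj B *m adj A) = rtr (A *m B) by rewrite -adjM rtr_adj.
by move: (rtr _) (rtr _) (rtr _) => x y z h; lra.
Qed.

Definition qf n (v : 'rV[C]_n) (X : 'M[C]_n) : R := Re ((v *m X *m adj v) 0 0).

Lemma qfE n (v : 'rV[C]_n) X : qf v X = rtr (v *m X *m adj v).
Proof. by rewrite /qf /rtr /mxtrace big_ord1. Qed.

Lemma qfD n (v : 'rV[C]_n) X Y : qf v (X + Y) = qf v X + qf v Y.
Proof. by rewrite !qfE mulmxDr mulmxDl rtrD. Qed.

Lemma qfN n (v : 'rV[C]_n) X : qf v (- X) = - qf v X.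
Proof. by rewrite !qfE mulmxN mulNmx rtrN. Qed.

Lemma qfZ n (v : 'rV[C]_n) a X : qf v (toC a *: X) = a * qf v X.
Proof. by rewrite !qfE -scalemxAr -scalemxAl rtrZ. Qed.

Lemma qf_sum n (v : 'rV[C]_n) (I : Type) (r : seq I) (P : pred I) (F : I -> 'M[C]_n) :
  qf v (\sum_(i <- r | P i) F i) = \sum_(i <- r | P i) qf v (F i).
Proof. by rewrite qfE mulmx_sumr mulmx_suml rtr_sum; apply: eq_bigr => i _; rewrite qfE. Qed.

Lemma qf_congr m n (v : 'rV[C]_n) (B : 'M[C]_(n, m)) X :
  qf v (B *m X *m adj B) = qf (v *m B) X.
Proof. by rewrite !qfE adjM !mulmxA. Qed.

Lemma qf_adjM_ge0 m n (v : 'rV[C]_n) (B : 'M[C]_(n, m)) : 0 <= qf v (B *m adj B).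
Proof. by rewrite qfE !mulmxA -(mulmxA (v *m B)) -adjM rtrC rtr_adjM_ge0. Qed.

Definition sdiag n (w : 'I_n -> R) : 'M[C]_n := diag_mx (\row_i toC (w i)).

(** The rows of [U] are the eigenvectors. With [U] and [w] explicit, eigenvalues are truncated by
    changing [w] alone. *)
Definition sp n (U : 'M[C]_n) (w : 'I_n -> R) : 'M[C]_n := adj U *m sdiag w *m U.

Lemma adj_sdiag n (w : 'I_n -> R) : adj (sdiag w) = sdiag w.
Proof.
rewrite /adj /sdiag tr_diag_mx map_diag_mx; congr diag_mx; apply/rowP => i.
by rewrite !mxE; exact: conj_toC.
Qed.

Lemma adj_sp n (U : 'M[C]_n) w : adj (sp U w) = sp U w.
Proof. by rewrite /sp !adjM adjK adj_sdiag mulmxA. Qed.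

Lemma rtr_sp n m (U : 'M[C]_n) w (X : 'M[C]_(n, m)) (Y : 'M[C]_(m, n)) :
  rtr (X *m (Y *m sp U w)) = \sum_i w i * qf (row i U) (X *m Y).
Proof.
rewrite mulmxA /sp !mulmxA rtrC !mulmxA rtrC.
rewrite /rtr /mxtrace Re_sum; apply: eq_bigr => i _.
rewrite /sdiag mul_diag_mx mxE [(\row__ _) _ _]mxE ReZ; congr (_ * Re _).
have -> : row i U *m (X *m Y) = row i (U *m X *m Y) by rewrite !row_mul mulmxA.
rewrite [LHS]mxE [RHS]mxE; apply: eq_bigr => j _.
by rewrite [row _ _ _ _]mxE; congr (_ * _); rewrite !mxE.
Qed.

Lemma spD n (U : 'M[C]_n) w w' : sp U w + sp U w' = sp U (fun i => w i + w' i).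
Proof.
rewrite /sp -mulmxDl -mulmxDr.
suff -> : sdiag w + sdiag w' = sdiag (fun i => w i + w' i) by [].
by apply/matrixP => i j; rewrite !mxE -mulrnDl toCD.
Qed.

Lemma eq_sp n (U : 'M[C]_n) w w' : w =1 w' -> sp U w = sp U w'.
Proof. by move=> /funext ->. Qed.

Section Unitary.
Variables (n : nat) (U : 'M[C]_n).
Hypothesis uU : U *m adj U = 1%:M.

Lemma unitary_adjl : adj U *m U = 1%:M.
Proof. exact: mulmx1C. Qed.

Lemma spM w w' : sp U w *m sp U w' = sp U (fun i => w i * w' i).
Proof.
rewrite /sp.
have -> : adj U *m sdiag w *m U *m (adj U *m sdiag w' *m U) =
    adj U *m (sdiag w *m (U *m adj U) *m sdiag w') *m U by rewrite !mulmxA.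
rewrite uU mulmx1.
suff -> : sdiag w *m sdiag w' = sdiag (fun i => w i * w' i) by [].
rewrite /sdiag mulmx_diag; congr diag_mx; apply/rowP => i.
by rewrite !mxE toCM.
Qed.

Lemma sp1 : sp U (fun=> 1) = 1%:M.
Proof.
rewrite /sp -[RHS]unitary_adjl; congr (_ *m _).
rewrite -[RHS]mulmx1; congr (_ *m _); apply/matrixP => i j.
by rewrite !mxE toC1.
Qed.

Lemma qf_row i : qf (row i U) 1%:M = 1.
Proof.
rewrite /qf mulmx1.
have -> : row i U *m adj (row i U) = (row i (U *m adj U)) *m (col i 1%:M).
  rewrite -row_mul -mulmxA; apply/matrixP => a b.
  rewrite !mxE; apply: eq_bigr => k _; rewrite !mxE; congr (_ * _).
  rewrite (bigD1 i) //= !mxE eqxx mulr1 big1 ?addr0 // => l li.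
  by rewrite !mxE (negPf li) mulr0.
rewrite uU !mxE (bigD1 i) //= !mxE eqxx mulr1 big1 ?addr0 // => l li.
by rewrite !mxE (negPf li) mulr0.
Qed.

Lemma rtr_sp1 w : rtr (sp U w) = \sum_i w i.
Proof.
rewrite -[sp U w]mul1mx -[X in rtr X]mul1mx rtr_sp; apply: eq_bigr => i _.
by rewrite mulmx1 qf_row mulr1.
Qed.

Lemma row_sp i w : row i U *m sp U w = toC (w i) *: row i U.
Proof.
rewrite /sp !mulmxA -!row_mul uU mul1mx /sdiag mul_diag_mx.
by apply/rowP => k; rewrite !mxE.
Qed.

Lemma qf_row_sp i w : qf (row i U) (sp U w) = w i.
Proof.
rewrite /qf row_sp -scalemxAl.
by rewrite -{1}[row i U]mulmx1 mxE ReZ -/(qf _ _) qf_row mulr1.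
Qed.

Lemma sp_le1 v w : (forall i, 0 <= w i <= 1) -> 0 <= qf v (sp U w) <= qf v 1%:M.
Proof.
move=> w01; have pos (f : 'I_n -> R) : (forall i, 0 <= f i) -> 0 <= qf v (sp U f).
  move=> f0; have -> : sp U f = sp U (fun i => Num.sqrt (f i)) *m adj (sp U (fun i => Num.sqrt (f i))).
    by rewrite adj_sp spM; apply: eq_sp => i; rewrite -expr2 sqr_sqrtr.
  exact: qf_adjM_ge0.
rewrite pos /=; last by move=> i; case/andP: (w01 i).
rewrite -sp1 -subr_ge0 -qfN -qfD.
have -> : - sp U w = sp U (fun i => - w i).
  apply/eqP; rewrite eq_sym -addr_eq0 spD; apply/eqP.
  rewrite /sp; have -> : sdiag (fun i => - w i + w i) = 0.
    by apply/matrixP => i j; rewrite !mxE addNr toC0 mul0rn.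
  by rewrite mulmx0 mul0mx.
by rewrite spD; apply: pos => i; rewrite subr_ge0; case/andP: (w01 i).
Qed.

End Unitary.

Lemma hermsym_sp n (A : 'M[C]_n) : adj A = A ->
  A = sp (spectralmx A) (fun i => Re (spectral_diag A 0 i)).
Proof.
move=> hA; have hs : A \is hermsymmx.
  by apply/is_hermitianmxP; rewrite expr0 scale1r.
have := @orthomx_spectralP _ _ A (hermitian_normalmx hs).
rewrite (invmx_unitary (spectral_unitarymx A)) => e; rewrite {1}e /sp.
apply: (congr1 (fun D => adj (spectralmx A) *m diag_mx D *m spectralmx A)).
apply/rowP => i; rewrite mxE; have /mxOverP/(_ 0 i) := hermitian_spectral_diag_real hs.
by move=> /RRe_real <-.
Qed.

Lemma mxfun_sp n (f : R -> R) (A : 'M[C]_n) :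
  mxfun f A = sp (spectralmx A) (fun i => f (Re (spectral_diag A 0 i))).
Proof.
rewrite /mxfun /sp; apply: (congr1 (fun D => adj (spectralmx A) *m diag_mx D *m spectralmx A)).
by apply/rowP => i; rewrite !mxE.
Qed.

Lemma spectral_unitary n (A : 'M[C]_n) : spectralmx A *m adj (spectralmx A) = 1%:M.
Proof. exact/unitarymxP/spectral_unitarymx. Qed.

Lemma trnorm_rtr n (A : 'M[C]_n) : trnorm A = rtr (mxfun Num.sqrt (adj A *m A)).
Proof. by []. Qed.

(* Unification would otherwise try to compare matrix products entrywise. *)
Opaque sp rtr qf adj mulmx.

(** Operator norm at most one, as a quadratic form; the order is [K *m adj K] because matrices act
    on row vectors from the right. *)
Definition contractive n (K : 'M[C]_n) :=
  forall v : 'rV_n, qf v (K *m adj K) <= qf v 1%:M.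

(** With [x] the squared norm of [v adj K], [amgm] and the bound for [K] at the vector [v adj K]
    give [2 x <= x + |v|^2]. *)
Lemma contractive_adj n (K : 'M[C]_n) : contractive K -> contractive (adj K).
Proof.
move=> cK v; rewrite adjK.
have := amgm (v *m (adj K *m K)) (adj v) 1; have := cK (v *m adj K).
rewrite !qfE expr1n mulr1 mul1r !adjM !adjK !mulmxA !mulmx1.
by move: (rtr _) (rtr _) (rtr _) => x y z h1 h2; lra.
Qed.

Lemma contractive_qf n (K : 'M[C]_n) v : contractive K -> qf v K <= qf v 1%:M.
Proof.
move=> cK; have := amgm (v *m K) (adj v) 1; have := cK v.
rewrite !qfE expr1n mulr1 mul1r !adjM !adjK !mulmxA !mulmx1.
by move: (rtr _) (rtr _) (rtr _) => x y z h1 h2; lra.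
Qed.

Section TraceNorm.
Variables (n : nat) (A : 'M[C]_n).
Let B := adj A *m A.
Let V := spectralmx B.
Let l i := Re (spectral_diag B 0 i).

Let uV : V *m adj V = 1%:M. Proof. exact: spectral_unitary. Qed.

Let BE : B = sp V l.
Proof. by apply: hermsym_sp; rewrite /B adjM adjK. Qed.

Let l_ge0 i : 0 <= l i.
Proof.
by rewrite -(qf_row_sp uV i l) -BE /B -{2}(adjK A) qf_adjM_ge0.
Qed.

Let trnormE : trnorm A = \sum_i Num.sqrt (l i).
Proof.
by rewrite trnorm_rtr mxfun_sp (rtr_sp1 uV).
Qed.

Lemma trnorm_ge0 : 0 <= trnorm A.
Proof. by rewrite trnormE sumr_ge0 // => i _; rewrite sqrtr_ge0. Qed.

Lemma trnorm_ge K : contractive K -> rtr (K *m A) <= trnorm A.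
Proof.
move=> cK; rewrite trnormE -[A]mulmx1 -(sp1 uV) rtr_sp; apply: ler_sum => i _.
rewrite mul1r; set x := qf _ _; set v := row i V in x *.
(* With the diagonal entry [x] itself as parameter this becomes [2 x^2 <= x^2 + l i]. *)
have := amgm (v *m K) (A *m adj v) x.
have -> : rtr (v *m K *m (A *m adj v)) = x by rewrite /x qfE !mulmxA.
have -> : rtr (adj (A *m adj v) *m (A *m adj v)) = l i.
  by rewrite -(qf_row_sp uV i l) -BE /B qfE adjM adjK !mulmxA.
have : rtr (v *m K *m adj (v *m K)) <= 1.
  by have := cK v; rewrite (qf_row uV) qfE adjM !mulmxA.
set a := rtr _ => a1 h.
have h2 : x ^+ 2 <= l i by have := sqr_ge0 x; nra.
case: (lerP x 0) => x0; first by rewrite (le_trans x0) // sqrtr_ge0.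
by rewrite -(ger0_norm (ltW x0)) -sqrtr_sqr ler_sqrt.
Qed.

(* The contraction is the adjoint of the partial isometry in the polar
   decomposition, [|A|^-1 A^*]; the junk value [0^-1 = 0] makes it vanish on the kernel. *)
Lemma trnorm_attained : exists2 K, contractive K & trnorm A = rtr (K *m A).
Proof.
pose s i := Num.sqrt (l i); exists (sp V (fun i => (s i)^-1) *m adj A).
  move=> v; set K := _ *m adj A.
  have -> : K *m adj K = sp V (fun i => (s i)^-1 * l i * (s i)^-1).
    by rewrite /K adjM adjK adj_sp mulmxA -(mulmxA _ (adj A)) -/B BE !spM.
  suff /(sp_le1 uV v) /andP[_ h] : forall i, 0 <= (s i)^-1 * l i * (s i)^-1 <= 1 by [].
  move=> i; rewrite /s.
  have := l_ge0 i; rewrite le_eqVlt => /predU1P[<-|l0].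
    by rewrite sqrtr0 invr0 !mulr0 lexx ler01.
  rewrite -{2 5}(sqr_sqrtr (ltW l0)) expr2 mulKf ?mulfV ?gt_eqF ?sqrtr_gt0 //.
  by rewrite ler01 lexx.
rewrite -mulmxA -/B BE (spM uV) (rtr_sp1 uV) trnormE; apply: eq_bigr => i _.
rewrite /s; have := l_ge0 i; rewrite le_eqVlt => /predU1P[<-|l0].
  by rewrite sqrtr0 invr0 !mulr0.
by rewrite -{3}(sqr_sqrtr (ltW l0)) expr2 mulKf // gt_eqF // sqrtr_gt0.
Qed.

End TraceNorm.

End LinearAlgebra.

(** * Chernoff bounds and the Farkas lemma *)

Section Classical.
Variable R : realType.

Lemma exists_le_mean (Y : finType) (q f : Y -> R) : is_dist q ->
  exists y, f y <= \sum_y q y * f y.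
Proof.
move=> [q0 q1]; apply: contrapT => /forallNP h.
have hlt y : \sum_y q y * f y < f y by rewrite ltNge; apply/negP; exact: h.
set m := \sum_y _ in h hlt.
have /eqP : \sum_y q y * (f y - m) = 0.
  under eq_bigr do rewrite mulrBr.
  by rewrite sumrB -mulr_suml q1 mul1r subrr.
rewrite psumr_eq0; last by move=> y _; rewrite mulr_ge0 // subr_ge0 ltW.
move=> /allP a0; have : \sum_y q y = 0.
  apply: big1 => y _; have := a0 y (mem_index_enum _).
  by rewrite mulf_eq0 subr_eq0 (gt_eqF (hlt y)) orbF => /eqP.
by rewrite q1 => /eqP; rewrite oner_eq0.
Qed.

Definition entropy (J : finType) (w : J -> R) : R := - \sum_j w j * ln (w j).

(** [1 - t <= expR (- t)] gives [(1 - t) * expR t <= 1], while [(1 - t) * (1 + t + 2 t^2) = 1 + t^2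
    * (1 - 2 t)] is at least 1. *)
Lemma expR_le_quad (t : R) : `|t| <= 1 / 2 -> expR t <= 1 + t + 2 * t ^+ 2.
Proof.
move=> ht; have [t1 t2] : - (1 / 2) <= t /\ t <= 1 / 2 by apply/andP; rewrite -ler_norml.
have h := expR_ge1Dx (- t); rewrite expRN in h.
have p := expR_gt0 t.
have h2 : (1 - t) * expR t <= 1.
  by rewrite -ler_pdivlMr // div1r.
have h3 : 1 <= (1 - t) * (1 + t + 2 * t ^+ 2) by have := sqr_ge0 t; nra.
by rewrite -(@ler_pM2l _ (1 - t)); [exact: (le_trans h2 h3)|lra].
Qed.

(** First-order expansion of the moment generating function at 0: for small [s] the slack [d]
    absorbs the quadratic term. *)
Lemma mgf_le (J : finType) (m l : J -> R) (d : R) : is_dist m -> 0 < d ->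
  exists2 s0, 0 < s0 & forall s, 0 < s <= s0 ->
    \sum_j m j * expR (s * l j) <= expR (s * (\sum_j m j * l j + d)).
Proof.
move=> [m0 m1] d0; pose B := 1 + \sum_j `|l j|.
have B1 : 1 <= B by rewrite lerDl sumr_ge0.
have lB j : `|l j| <= B.
  by rewrite /B (bigD1 j) //= addrCA lerDl addr_ge0 // sumr_ge0.
(* The first bound brings [s * l j] into the range of [expR_le_quad]; the second makes the remainder
   [2 (s B)^2] at most [s d]. *)
pose s0 := Num.min (1 / (2 * B)) (d / (2 * B ^+ 2)).
have B0 : 0 < B by lra.
exists s0; first by rewrite lt_min !divr_gt0 ?mulr_gt0 ?exprn_gt0.
move=> s /andP[sp]; rewrite le_min => /andP[].
rewrite !ler_pdivlMr ?mulr_gt0 ?exprn_gt0 // => s1 s2.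
apply: (@le_trans _ _ (1 + s * (\sum_j m j * l j + d))); last exact: expR_ge1Dx.
apply: (@le_trans _ _ (\sum_j m j * (1 + s * l j + s * d))); last first.
  rewrite le_eqVlt; apply/orP; left; apply/eqP.
  have -> : \sum_j m j * (1 + s * l j + s * d) =
     (1 + s * d) * (\sum_j m j) + s * (\sum_j m j * l j).
    by rewrite !mulr_sumr -big_split; apply: eq_bigr => j _ /=; ring.
  by rewrite m1; ring.
apply: ler_sum => j _; apply: ler_wpM2l => //.
have aj := lB j; have n0 := normr_ge0 (l j).
have sl : `|s * l j| <= 1 / 2 by rewrite normrM (gtr0_norm sp); nra.
apply: (le_trans (expR_le_quad sl)); rewrite lerD2l.
have : l j ^+ 2 <= B ^+ 2 by rewrite -(real_normK (num_real (l j))) ler_pXn2r // nnegrE ?(ltW B0).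
rewrite exprMn; have := sqr_ge0 (l j); move: (l j ^+ 2) (B ^+ 2) s2 => x y s2 x0 xy.
nra.
Qed.

Lemma mgf_uniform (X J : finType) (m l : X -> J -> R) (d : R) :
  (forall x, is_dist (m x)) -> 0 < d ->
  exists2 s0, 0 < s0 & forall s x, 0 < s <= s0 ->
    \sum_j m x j * expR (s * l x j) <= expR (s * (\sum_j m x j * l x j + d)).
Proof.
move=> hm d0.
have /choice [f hf] : forall x, exists s, 0 < s /\ forall s', 0 < s' <= s ->
    \sum_j m x j * expR (s' * l x j) <= expR (s' * (\sum_j m x j * l x j + d)).
  by move=> x; have [s sp hs] := mgf_le (l x) (hm x) d0; exists s.
exists (\big[Num.min/1]_x f x).
  by apply: (big_ind (fun x => 0 < x)) => // [x y x0 y0|x _]; [rewrite lt_min x0|case: (hf x)].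
move=> s x /andP[sp hs]; apply: (hf x).2; rewrite sp (le_trans hs) //.
by rewrite (bigD1 x) //= ge_min lexx.
Qed.

Lemma sum_ffun_prod (n : nat) (J : finType) (F : 'I_n -> J -> R) :
  \sum_(j : {ffun 'I_n -> J}) \prod_k F k (j k) = \prod_k \sum_j F k j.
Proof. by rewrite bigA_distr_bigA. Qed.

(** Markov's inequality for the exponential of the sum, which factors over coordinates. The law of
    coordinate [k] depends on the letter [x k], so one [s] has to serve all letters. *)
Lemma chernoff (X J : finType) (m l : X -> J -> R) (d s : R) n (x : 'I_n -> X) (t : R) :
  (forall x j, 0 <= m x j) -> 0 < s ->
  (forall x, \sum_j m x j * expR (s * l x j) <= expR (s * (\sum_j m x j * l x j + d))) ->
  \sum_(j : {ffun 'I_n -> J} | t <= \sum_k l (x k) (j k)) \prod_k m (x k) (j k)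
    <= expR (- (s * (t - \sum_k \sum_j m (x k) j * l (x k) j - n%:R * d))).
Proof.
move=> m0 sp h.
apply: (@le_trans _ _ (\sum_(j : {ffun 'I_n -> J})
   expR (- (s * t)) * \prod_k (m (x k) (j k) * expR (s * l (x k) (j k))))).
  rewrite big_mkcond; apply: ler_sum => j _; rewrite big_split /= -expR_sum -mulr_sumr.
  rewrite mulrCA -expRD; case: ifPn => [ht|_].
    rewrite ler_peMr ?prodr_ge0 // -expR0 ler_expR addrC -mulrBr mulr_ge0 ?(ltW sp) //.
    by rewrite subr_ge0.
  by rewrite mulr_ge0 ?prodr_ge0 // expR_ge0.
rewrite -mulr_sumr (sum_ffun_prod (fun k i => m (x k) i * expR (s * l (x k) i))).
apply: (@le_trans _ _ (expR (- (s * t)) * \prod_k expR (s * (\sum_j m (x k) j * l (x k) j + d)))).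
  apply: ler_wpM2l; first exact: expR_ge0.
  apply: ler_prod => k _; rewrite h andbT; apply: sumr_ge0 => j _.
  by rewrite mulr_ge0 // expR_ge0.
rewrite -expR_sum -expRD ler_expR -mulr_sumr big_split /= sumr_const card_ord -mulr_natl.
by lra.
Qed.

Lemma prod_ln (n : nat) (a : 'I_n -> R) : (forall k, 0 <= a k) ->
  \prod_k a k != 0 -> \prod_k a k = expR (\sum_k ln (a k)).
Proof.
move=> a0 /prodf_neq0 h; rewrite expR_sum; apply: eq_bigr => k _.
by rewrite lnK // posrE lt0r h // a0.
Qed.

Section Tails.
Variables (X J : finType) (w : X -> J -> R).
Hypothesis w_dist : forall x, is_dist (w x).

Lemma lower_tail (d s : R) n (x : 'I_n -> X) (t : R) : 0 < s ->
  (forall x, \sum_j w x j * expR (s * - ln (w x j)) <=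
     expR (s * (\sum_j w x j * - ln (w x j) + d))) ->
  \sum_(j : {ffun 'I_n -> J} | \prod_k w (x k) (j k) < expR (- t)) \prod_k w (x k) (j k)
    <= expR (- (s * (t - \sum_k entropy (w (x k)) - n%:R * d))).
Proof.
move=> sp h; have w0 y j : 0 <= w y j by case: (w_dist y).
have -> : \sum_k entropy (w (x k)) = \sum_k \sum_j w (x k) j * - ln (w (x k) j).
  by apply: eq_bigr => k _; rewrite /entropy -sumrN; apply: eq_bigr => j _; rewrite mulrN.
apply: le_trans (chernoff _ _ w0 sp h).
rewrite big_mkcond [leRHS]big_mkcond; apply: ler_sum => j _.
case: ifPn => [lt|_]; last by case: ifP => // _; apply: prodr_ge0.
case: ifPn => //; rewrite -ltNge => ht.
(* A vanishing product carries no mass; it is set aside because [ln 0 = 0] would break the passage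
   to a sum of logarithms. *)
have [->//|n0] := eqVneq (\prod_k w (x k) (j k)) 0.
move: lt; rewrite prod_ln // ltr_expR sumrN in ht *; lra.
Qed.

Lemma upper_tail (d s : R) n (x : 'I_n -> X) (t : R) : 0 < s ->
  (forall x, \sum_j w x j * expR (s * ln (w x j)) <=
     expR (s * (\sum_j w x j * ln (w x j) + d))) ->
  \sum_(j : {ffun 'I_n -> J} | expR (- t) < \prod_k w (x k) (j k)) \prod_k w (x k) (j k)
    <= expR (- (s * (\sum_k entropy (w (x k)) - t - n%:R * d))).
Proof.
move=> sp h; have w0 y j : 0 <= w y j by case: (w_dist y).
apply: (@le_trans _ _ (expR (- (s * (- t - \sum_k \sum_j w (x k) j * ln (w (x k) j) - n%:R * d))))); last first.
  have -> : \sum_k entropy (w (x k)) = - \sum_k \sum_j w (x k) j * ln (w (x k) j).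
    by rewrite -sumrN.
  by rewrite ler_expR; lra.
apply: le_trans (chernoff _ _ w0 sp h).
rewrite big_mkcond [leRHS]big_mkcond; apply: ler_sum => j _.
case: ifPn => [lt|_]; last by case: ifP => // _; apply: prodr_ge0.
case: ifPn => //; rewrite -ltNge => ht.
have [->//|n0] := eqVneq (\prod_k w (x k) (j k)) 0.
by move: lt; rewrite prod_ln // ltr_expR => lt; lra.
Qed.

End Tails.

(* Bartl's inductive proof of the Farkas lemma. *)
Lemma farkas (V : lmodType R) (N : nat) (f : 'I_N -> V -> R) (g : V -> R) :
  (forall i a x y, f i (a *: x + y) = a * f i x + f i y) ->
  (forall a x y, g (a *: x + y) = a * g x + g y) ->
  (forall x, (forall i, f i x <= 0) -> g x <= 0) ->
  exists2 c : 'I_N -> R, (forall i, 0 <= c i) & forall x, g x = \sum_i c i * f i x.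
Proof.
have lin0 (k : V -> R) : (forall a x y, k (a *: x + y) = a * k x + k y) -> k 0 = 0.
  by move=> kL; have := kL 1 0 0; rewrite scaler0 addr0 mul1r; lra.
elim: N f g => [|N IH] f g fL gL h.
  exists (fun=> 0) => // x; rewrite big_ord0; apply/eqP.
  have h1 : g x <= 0 by apply: h; case.
  have : g (- x) <= 0 by apply: h; case.
  by rewrite -[- x]addr0 -scaleN1r gL (lin0 g gL); lra.
have fd i x a y : f i (x - a *: y) = f i x - a * f i y.
  by rewrite addrC -scaleNr fL; lra.
have gd x a y : g (x - a *: y) = g x - a * g y.
  by rewrite addrC -scaleNr gL; lra.
have [h'|] := pselect (forall x, (forall i, f (lift ord0 i) x <= 0) -> g x <= 0).
  have [c c0 hc] := IH (fun i => f (lift ord0 i)) g (fun i => fL _) gL h'.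
  exists (fun i => if unlift ord0 i is Some j then c j else 0).
    by move=> i; case: (unlift ord0 i).
  move=> x; rewrite hc big_ord_recl unlift_none mul0r add0r.
  by apply: eq_bigr => i _; rewrite liftK.
move=> /existsNP [z /not_implyP [fz /negP]]; rewrite -ltNge => gz.
have f0z : 0 < f ord0 z.
  rewrite ltNge; apply/negP => f0; suff : g z <= 0 by lra.
  by apply: h => i; case: (unliftP ord0 i) => [j ->|->].
(* Projection along [z] onto the kernel of [f ord0], where the induction hypothesis applies. The
   multiplier of [f ord0] is then read off at [z]; it is nonnegative since [g z > 0] and the other
   [f i z] are at most 0. *)
pose pr x := x - (f ord0 x / f ord0 z) *: z.
have prL a x y : pr (a *: x + y) = a *: pr x + pr y.
  rewrite /pr fL mulrDl scalerDl scalerBr scalerA mulrA opprD.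
  by rewrite !addrA; congr (_ + _); rewrite addrAC.
have [c c0 hc] : exists2 c : 'I_N -> R, (forall i, 0 <= c i) &
    forall x, g (pr x) = \sum_i c i * f (lift ord0 i) (pr x).
  apply: (IH (fun i x => f (lift ord0 i) (pr x)) (fun x => g (pr x))).
  - by move=> i a x y; rewrite prL fL.
  - by move=> a x y; rewrite prL gL.
  - move=> x hx; apply: h => i; case: (unliftP ord0 i) => [j ->//|->].
    by rewrite fd divfK ?subrr // gt_eqF.
exists (fun i => if unlift ord0 i is Some j then c j else
     (g z - \sum_i c i * f (lift ord0 i) z) / f ord0 z).
  move=> i; case: (unlift ord0 i) => //; apply: divr_ge0; last exact: ltW.
  rewrite subr_ge0; apply: (@le_trans _ _ 0); last exact: ltW.
  by apply: sumr_le0 => j _; apply: mulr_ge0_le0.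
move=> x; rewrite big_ord_recl unlift_none.
rewrite [X in _ = _ + X](eq_bigr (fun i => c i * f (lift ord0 i) x)); last first.
  by move=> i _; rewrite liftK.
have e := hc x; rewrite gd in e.
have e2 : \sum_i c i * f (lift ord0 i) (pr x) = \sum_i c i * f (lift ord0 i) x -
    f ord0 x / f ord0 z * \sum_i c i * f (lift ord0 i) z.
  by rewrite mulr_sumr -sumrB; apply: eq_bigr => i _; rewrite fd; ring.
rewrite e2 in e.
have -> : g x = f ord0 x / f ord0 z * g z + (g x - f ord0 x / f ord0 z * g z) by ring.
by rewrite e; ring.
Qed.

End Classical.

(** * One-shot bounds *)

Section OneShot.
Variable R : realType.
Local Notation C := R[i].

Lemma contractiveN n (K : 'M[C]_n) : contractive K -> contractive (- K).
Proof. by move=> cK v; rewrite adjN mulmxN mulNmx opprK. Qed.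

Lemma rtr_contractive_sp n (K U : 'M[C]_n) w : contractive K -> U *m adj U = 1%:M ->
  (forall i, 0 <= w i) -> rtr (K *m sp U w) <= \sum_i w i.
Proof.
move=> cK uU w0; rewrite -[sp U w]mul1mx rtr_sp mulmx1; apply: ler_sum => i _.
by rewrite ler_piMr // -(qf_row uU i) contractive_qf.
Qed.

Lemma sp_sqrt n (U : 'M[C]_n) w : U *m adj U = 1%:M -> (forall i, 0 <= w i) ->
  exists2 S, adj S = S & sp U w = S *m S.
Proof.
move=> uU w0; exists (sp U (fun i => Num.sqrt (w i))); first exact: adj_sp.
by rewrite (spM uU); apply: eq_sp => i; rewrite -expr2 sqr_sqrtr.
Qed.

(** Gentle measurement: with [S] the root of the state, cyclicity splits the trace into the factors
    [S P] and [K S], to which [amgm] applies although [P] and the state need not commute. *)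
Lemma rtr_contractive_gentle n (K U P : 'M[C]_n) w t : contractive K ->
  U *m adj U = 1%:M -> (forall i, 0 <= w i) -> adj P = P -> P *m P = P ->
  2 * t * rtr (K *m (sp U w *m P)) <= t ^+ 2 * rtr (sp U w *m P) + \sum_i w i.
Proof.
move=> cK uU w0 aP pP; have [S aS SS] := sp_sqrt uU w0.
have := amgm (S *m P) (K *m S) t.
have -> : rtr (S *m P *m (K *m S)) = rtr (K *m (sp U w *m P)).
  by rewrite (rtrC (S *m P)) SS !mulmxA.
have -> : rtr (S *m P *m adj (S *m P)) = rtr (sp U w *m P).
  by rewrite adjM aS aP mulmxA -(mulmxA S P P) pP (rtrC (S *m P)) mulmxA -SS.
move=> h; apply: (le_trans h); rewrite lerD2l adjM aS.
have -> : rtr (S *m adj K *m (K *m S)) = rtr (adj K *m (K *m sp U w)).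
  by rewrite -(mulmxA S) (rtrC S) SS !mulmxA.
rewrite rtr_sp; apply: ler_sum => i _.
by rewrite ler_piMr // -(qf_row uU i) -{2}(adjK K); apply/contractive_adj.
Qed.

(** The squared Hilbert-Schmidt norm of [P K] is at most the rank of [P]; this converts
    Hilbert-Schmidt bounds into trace-norm bounds. *)
Lemma rtr_proj_contractive n (V K : 'M[C]_n) c (P := sp V c) : V *m adj V = 1%:M ->
  contractive K -> (forall i, 0 <= c i) -> P *m P = P ->
  rtr (P *m K *m adj (P *m K)) <= rtr P.
Proof.
move=> uV cK c0 PP; rewrite adjM adj_sp -/P.
have -> : rtr (P *m K *m (adj K *m P)) = rtr (K *m (adj K *m P)).
  by rewrite -(mulmxA P) rtrC -(mulmxA K) -(mulmxA (adj K)) PP.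
rewrite /P rtr_sp (rtr_sp1 uV); apply: ler_sum => i _.
by rewrite ler_piMr // -(qf_row uV i); exact: cK.
Qed.

Lemma sum_seq_const n (I : Type) (s : seq I) (A : 'M[C]_n) :
  \sum_(y <- s) A = toC (size s)%:R *: A.
Proof.
elim: s => [|y s IH]; first by rewrite big_nil toC0 scale0r.
by rewrite big_cons IH -{1}[A]scale1r -scalerDl -toC1 -toCD nat1r.
Qed.

(** Only the centred sum [S], compressed by [P] on one side, is estimated through cancellation
    between target and codebook; the four other traces are bounded separately. *)
Lemma rtr_split_along n (a : R) (K rho1 rho2 A A' S P P' : 'M[C]_n) :
  P + P' = 1%:M -> toC a *: S = rho1 - toC a *: A ->
  rtr (K *m (rho1 + rho2 - toC a *: (A + A'))) =
  a * rtr (K *m (S *m P)) + (rtr (K *m (rho1 *m P')) - a * rtr (K *m (A *m P')))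
  + (rtr (K *m rho2) - a * rtr (K *m A')).
Proof.
move=> PP' aS; rewrite -!rtrZ !(scalemxAr (toC a) K) -!rtrB -!rtrD -!mulmxBr -!mulmxDr.
congr (rtr (_ *m _)).
have -> : rho1 *m P' - toC a *: (A *m P') = (toC a *: S) *m P'.
  by rewrite aS mulmxBl scalemxAl.
by rewrite scalemxAl -mulmxDr PP' mulmx1 aS scalerDr opprD addrACA.
Qed.

Lemma proj_compl n (P : 'M[C]_n) : P *m P = P -> (1%:M - P) *m (1%:M - P) = 1%:M - P.
Proof. by move=> PP; rewrite mulmxBl mul1mx mulmxBr mulmx1 PP subrr subr0. Qed.

Section Greedy.
Variables (Y : finType) (q l : Y -> R) (n : nat) (Z : Y -> 'M[C]_n) (k : R).
Hypotheses (q_dist : is_dist q) (Z0 : \sum_y toC (q y) *: Z y = 0).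

(* Choosing each codeword to be no worse than average derandomizes the i.i.d. codebook. *)
Lemma greedy_codebook (M : nat) : exists2 s : seq Y, size s = M &
  \sum_(y <- s) l y + k * rtr (adj (\sum_(y <- s) Z y) *m \sum_(y <- s) Z y) <=
  M%:R * (\sum_y q y * (l y + k * rtr (adj (Z y) *m Z y))).
Proof.
elim: M => [|M [s sz hs]].
  by exists [::]; rewrite // !big_nil mulmx0 rtr0 mulr0 mul0r addr0.
set S := \sum_(y <- s) Z y in hs.
(* This is the increment of the potential when [y] is added. Its cross term averages to zero because
   [Z] is centred, so the expected growth is linear in [M]. *)
have [y hy] := exists_le_mean (fun y => l y + k * (rtr (adj (Z y) *m Z y) + 2 * rtr (adj S *m Z y))) q_dist.
exists (y :: s); first by rewrite /= sz.
have ES : \sum_y q y * rtr (adj S *m Z y) = 0.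
  transitivity (rtr (adj S *m \sum_y toC (q y) *: Z y)); last by rewrite Z0 mulmx0 rtr0.
  by rewrite mulmx_sumr rtr_sum; apply: eq_bigr => z _; rewrite -scalemxAr rtrZ.
have E : \sum_y q y * (l y + k * (rtr (adj (Z y) *m Z y) + 2 * rtr (adj S *m Z y))) =
  \sum_y q y * (l y + k * rtr (adj (Z y) *m Z y)).
  transitivity (\sum_y (q y * (l y + k * rtr (adj (Z y) *m Z y)) + 2 * k * (q y * rtr (adj S *m Z y)))).
    by apply: eq_bigr => z _; move: (rtr _) (rtr _) => a b; ring.
  by rewrite big_split /= -mulr_sumr ES mulr0 addr0.
rewrite E in hy; rewrite !big_cons -/S adjD mulmxDl !mulmxDr !rtrD.
have -> : rtr (adj (Z y) *m S) = rtr (adj S *m Z y).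
  by rewrite -rtr_adj adjM adjK.
rewrite -natr1 mulrDl mul1r.
move: (rtr _) (rtr _) (rtr _) hs hy => a b c hs hy; lra.
Qed.

End Greedy.

(** [x1] to [x5] stand for the traces of [rtr_split_along] against [S P], [rho1 Pc], [rho2], [A Pc]
    and [A']; [x6], [x8] and [x7] are the codebook costs bounding the first, fourth and fifth. *)
Lemma achievability_arith (m th x1 x2 x3 x4 x5 x6 x7 x8 : R) : 0 < m ->
  m^-1 * x1 <= th / 2 + m^-1 * x6 -> x2 <= th -> x3 <= th ^+ 2 ->
  - x4 <= x8 + m * (th / 2) -> - x5 <= x7 ->
  m * (m^-1 * x1 + (x2 - m^-1 * x4) + (x3 - m^-1 * x5)) <=
  m * (th ^+ 2 + 2 * th) + (x7 + x8 + x6).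
Proof.
move=> m0 h1 h2 h3 h4 h5.
have -> : m * (m^-1 * x1 + (x2 - m^-1 * x4) + (x3 - m^-1 * x5)) =
  m * (m^-1 * x1) + m * x2 - x4 + m * x3 - x5 by field; rewrite gt_eqF.
have k1 := ler_wpM2l (ltW m0) h1.
have k2 := ler_wpM2l (ltW m0) h2.
have k3 := ler_wpM2l (ltW m0) h3.
have e6 : m * (th / 2 + m^-1 * x6) = m * (th / 2) + x6 by field; rewrite gt_eqF.
rewrite e6 in k1; lra.
Qed.

(** * Achievability for a single block *)

Section Achievability.
Variables (Y : finType) (q : Y -> R) (N : nat) (U : Y -> 'M[C]_N) (w : Y -> 'I_N -> R).
Variables (V : 'M[C]_N) (r : 'I_N -> R) (mu lam th : R) (M : nat).
Hypotheses (q_dist : is_dist q) (uU : forall y, U y *m adj (U y) = 1%:M)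
  (uV : V *m adj V = 1%:M) (w_dist : forall y, is_dist (w y)) (r_dist : is_dist r).
Let rho := \sum_y toC (q y) *: sp (U y) (w y).
Hypotheses (rhoE : rho = sp V r) (mu0 : 0 <= mu) (lam0 : 0 < lam) (th01 : 0 < th <= 1)
  (M0 : (0 < M)%N)
  (tail_w : \sum_y q y * \sum_(j | mu < w y j) w y j <= th ^+ 2)
  (tail_r : \sum_(i | r i < lam) r i <= th ^+ 2)
  (rate : mu <= th ^+ 2 * M%:R * lam).

Let wl y j := if w y j <= mu then w y j else 0.
Let wh y j := if mu < w y j then w y j else 0.
Let A y := sp (U y) (wl y).
Let A' y := sp (U y) (wh y).
Let P := sp V (fun i => if lam <= r i then 1 else 0).
Let Pc := sp V (fun i => if r i < lam then 1 else 0).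
Let rho1 := \sum_y toC (q y) *: A y.
Let rho2 := \sum_y toC (q y) *: A' y.
Let Z y := rho1 - A y.

Let q0 y : 0 <= q y. Proof. by case: q_dist. Qed.
Let w0 y j : 0 <= w y j. Proof. by case: (w_dist y). Qed.
Let r0 i : 0 <= r i. Proof. by case: r_dist. Qed.
Let wl0 y j : 0 <= wl y j. Proof. by rewrite /wl; case: ifP. Qed.
Let wh0 y j : 0 <= wh y j. Proof. by rewrite /wh; case: ifP. Qed.

Let AA' y : sp (U y) (w y) = A y + A' y.
Proof.
rewrite /A /A' spD; apply: eq_sp => j; rewrite /wl /wh.
by case: ltP => _; rewrite ?addr0 ?add0r.
Qed.

Let rho12 : rho = rho1 + rho2.
Proof.
by rewrite /rho /rho1 /rho2 -big_split; apply: eq_bigr => y _; rewrite AA' scalerDr.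
Qed.

Let PPc : P + Pc = 1%:M.
Proof.
rewrite /P /Pc spD -(sp1 uV); apply: eq_sp => i.
by case: ltP => _; rewrite ?addr0 ?add0r.
Qed.

Let aP : adj P = P. Proof. exact: adj_sp. Qed.
Let aPc : adj Pc = Pc. Proof. exact: adj_sp. Qed.
Let idP : P *m P = P.
Proof. by rewrite /P (spM uV); apply: eq_sp => i; case: ifP; rewrite ?mul1r ?mul0r. Qed.
Let idPc : Pc *m Pc = Pc.
Proof. by rewrite /Pc (spM uV); apply: eq_sp => i; case: ifP; rewrite ?mul1r ?mul0r. Qed.

Let rtrP : rtr P <= lam^-1.
Proof.
rewrite /P (rtr_sp1 uV) -[leRHS](mulr1 lam^-1) -[X in _ <= _ * X](r_dist.2) mulr_sumr.
apply: ler_sum => i _; rewrite mulrC ler_pdivlMr //.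
by case: ifP => h; rewrite ?mul1r ?mul0r // r0.
Qed.

Let q_sum_rtr (F : Y -> 'M[C]_N) K : \sum_y q y * rtr (K *m F y) = rtr (K *m \sum_y toC (q y) *: F y).
Proof.
by rewrite mulmx_sumr rtr_sum; apply: eq_bigr => y _; rewrite -scalemxAr rtrZ.
Qed.

Let rtr_A y : rtr (A y) <= 1.
Proof.
rewrite /A (rtr_sp1 (uU y)) -(w_dist y).2; apply: ler_sum => j _.
by rewrite /wl; case: ifP.
Qed.

Let mean_A' : \sum_y q y * rtr (A' y) <= th ^+ 2.
Proof.
apply: le_trans tail_w; apply: ler_sum => y _; apply: ler_wpM2l => //.
by rewrite /A' (rtr_sp1 (uU y)) /wh -big_mkcond.
Qed.

Let rtr_A'Pc y : 0 <= rtr (A' y *m Pc).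
Proof.
rewrite rtrC -[A' y]mul1mx /A' rtr_sp mulmx1; apply: sumr_ge0 => j _.
rewrite mulr_ge0 //.
have /(sp_le1 uV (row j (U y))) /andP[] // : forall i, 0 <= (if r i < lam then 1 else 0 : R) <= 1.
by move=> i; case: ifP => _; rewrite ?lexx ?ler01.
Qed.

(** Restoring the cut part [A'] can only increase the trace, and the full states average to [rho],
    whose weight under [Pc] is the tail of [r]. *)
Let mean_APc : \sum_y q y * rtr (A y *m Pc) <= th ^+ 2.
Proof.
apply: le_trans tail_r; have -> : \sum_(i | r i < lam) r i = rtr (Pc *m rho).
  rewrite rhoE /Pc (spM uV) (rtr_sp1 uV) [LHS]big_mkcond; apply: eq_bigr => i _.
  by case: ifP => _; rewrite ?mul1r ?mul0r.
rewrite -q_sum_rtr; apply: ler_sum => y _; apply: ler_wpM2l => //.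
by rewrite AA' mulmxDr rtrD rtrC lerDl rtrC.
Qed.

Let Z_mean0 : \sum_y toC (q y) *: Z y = 0.
Proof.
rewrite /Z; under eq_bigr do rewrite scalerBr.
by rewrite sumrB -scaler_suml -toC_sum q_dist.2 toC1 scale1r subrr.
Qed.

(** The variance is at most the second moment, and a state whose eigenvalues are cut at [mu] has
    squared Hilbert-Schmidt norm at most [mu]. *)
Let Z_var : \sum_y q y * rtr (adj (Z y) *m Z y) <= mu.
Proof.
have aA y : adj (A y) = A y by exact: adj_sp.
have arho : adj rho1 = rho1.
  by rewrite /rho1 adj_sum; apply: eq_bigr => y _; rewrite adjZ aA.
have -> : \sum_y q y * rtr (adj (Z y) *m Z y) =
    \sum_y q y * rtr (A y *m A y) - rtr (rho1 *m rho1).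
  have -> : \sum_y q y * rtr (adj (Z y) *m Z y) =
     \sum_y (q y * rtr (A y *m A y) + q y * rtr (rho1 *m rho1) - 2 * (q y * rtr (rho1 *m A y))).
    apply: eq_bigr => y _; rewrite /Z adjD adjN aA arho mulmxBl !mulmxBr !rtrB.
    by rewrite (rtrC (A y) rho1); move: (rtr _) (rtr _) (rtr _) => a b c; ring.
  rewrite sumrB big_split /= -mulr_suml q_dist.2 -mulr_sumr q_sum_rtr -/rho1 mul1r.
  by move: (rtr _) (\sum_y _) => a b; ring.
have rr : 0 <= rtr (rho1 *m rho1) by rewrite -{1}arho rtr_adjM_ge0.
apply: (@le_trans _ _ (\sum_y q y * rtr (A y *m A y))); first by rewrite lerBlDr lerDl.
rewrite -[leRHS]mul1r -q_dist.2 mulr_suml; apply: ler_sum => y _; apply: ler_wpM2l => //.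
rewrite /A (spM (uU y)) (rtr_sp1 (uU y)) -[leRHS]mulr1 -(w_dist y).2 mulr_sumr.
apply: ler_sum => j _; rewrite /wl; case: ifP => h; first exact: ler_wpM2r.
by rewrite mul0r mulr_ge0.
Qed.

(** [K] does not occur on the right, so the codebook can be fixed before the contraction that
    attains its trace norm. *)
Let bound (s : seq Y) K S : contractive K -> size s = M -> S = \sum_(y <- s) Z y ->
  M%:R * rtr (K *m (rho - toC M%:R^-1 *: \sum_(y <- s) sp (U y) (w y))) <=
  M%:R * (th ^+ 2 + 2 * th) +
  (\sum_(y <- s) (rtr (A' y) + rtr (A y *m Pc) / (2 * th)) +
    (2 * lam * th * M%:R)^-1 * rtr (adj S *m S)).
Proof.
move=> cK sz SE0; have /andP[th0 th1] := th01.
have cNK := contractiveN cK.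
have m0 : (0 : R) < M%:R by rewrite ltr0n.
have gentle y (K' : 'M[C]_N) : contractive K' ->
    rtr (K' *m (A y *m Pc)) <= rtr (A y *m Pc) / (2 * th) + th / 2.
  move=> cK'.
  (* With parameter [th^-1], a tail of order [th^2] costs only order [th]. *)
  have := rtr_contractive_gentle th^-1 cK' (uU y) (wl0 y) aPc idPc.
  rewrite -/(A y); have := rtr_A y; rewrite {1}/A (rtr_sp1 (uU y)).
  move: (rtr _) (rtr _) (\sum_i _) => a b c c1 h.
  rewrite -(@ler_pM2l _ (2 * th^-1)) ?mulr_gt0 ?invr_gt0 //.
  apply: (le_trans h).
  have -> : 2 / th * (a / (2 * th) + th / 2) = th^-1 ^+ 2 * a + 1 by field; rewrite gt_eqF.
  by rewrite lerD2l.
have g1 : rtr (K *m (rho1 *m Pc)) <= th.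
  rewrite mulmx_suml mulmx_sumr rtr_sum.
  apply: (@le_trans _ _ (\sum_y q y * (rtr (A y *m Pc) / (2 * th) + th / 2))).
    apply: ler_sum => y _; rewrite -scalemxAl -scalemxAr rtrZ.
    by apply: ler_wpM2l => //; exact: gentle.
  under eq_bigr do rewrite mulrDr mulrA.
  rewrite big_split /= -!mulr_suml q_dist.2.
  have : (\sum_y q y * rtr (A y *m Pc)) / (2 * th) <= th / 2.
    rewrite ler_pdivrMr ?mulr_gt0 //.
    have -> : th / 2 * (2 * th) = th ^+ 2 by field.
    exact: mean_APc.
  lra.
have tl : rtr (K *m rho2) <= th ^+ 2.
  rewrite -q_sum_rtr; apply: le_trans mean_A'; apply: ler_sum => y _; apply: ler_wpM2l => //.
  by rewrite {2}/A' (rtr_sp1 (uU y)); apply: rtr_contractive_sp.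
have flat : M%:R^-1 * rtr (K *m (S *m P)) <= th / 2 + M%:R^-1 * ((2 * lam * th * M%:R)^-1 * rtr (adj S *m S)).
  (* The parameter makes the rank bound [lam^-1] contribute exactly [th / 2] after division by
     [M]. *)
  have := amgm (P *m K) S (M%:R * lam * th).
  have -> : rtr (P *m K *m S) = rtr (K *m (S *m P)) by rewrite -mulmxA rtrC mulmxA.
  have : rtr (P *m K *m adj (P *m K)) <= lam^-1.
    by apply: le_trans rtrP; apply: (rtr_proj_contractive uV cK) => [i|]; [case: ifP|exact: idP].
  move: (rtr _) (rtr _) (rtr _) => c b a ha h.
  have p0 : 0 < 2 * (M%:R * lam * th) by rewrite !mulr_gt0.
  have h2 : b <= (M%:R * lam * th) / 2 * a + (2 * (M%:R * lam * th))^-1 * c.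
    rewrite -(ler_pM2l p0); apply: (le_trans h).
    rewrite le_eqVlt; apply/orP; left; apply/eqP; field.
    by rewrite !gt_eqF.
  rewrite mulrC ler_pdivrMr //; apply: (le_trans h2).
  have -> : (th / 2 + M%:R^-1 * ((2 * lam * th * M%:R)^-1 * c)) * M%:R =
      (M%:R * lam * th) / 2 * lam^-1 + (2 * (M%:R * lam * th))^-1 * c.
    by field; rewrite !gt_eqF.
  rewrite lerD2r; apply: ler_wpM2l => //.
  by rewrite divr_ge0 // !mulr_ge0 // ltW.
pose a := toC M%:R^-1 : C; pose B := \sum_(y <- s) A y; pose B' := \sum_(y <- s) A' y.
have aSE : a *: S = rho1 - a *: B.
  have -> : S = toC M%:R *: rho1 - B.
    rewrite SE0 /Z sumrB -/B -sz; congr (_ - _).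
    exact: sum_seq_const.
  by rewrite scalerBr scalerA /a -toCM mulVf ?gt_eqF // toC1 scale1r.
have -> : \sum_(y <- s) sp (U y) (w y) = B + B'.
  by rewrite -big_split; apply: eq_bigr => y _; exact: AA'.
rewrite rho12 (rtr_split_along K rho2 B' PPc aSE).
have gB : - rtr (K *m (B *m Pc)) <= \sum_(y <- s) rtr (A y *m Pc) / (2 * th) + M%:R * (th / 2).
  have -> : M%:R * (th / 2) = \sum_(y <- s) th / 2.
    by rewrite big_const_seq count_predT sz iter_addr_0 mulr_natl.
  rewrite -big_split -rtrN -mulNmx mulmx_suml mulmx_sumr rtr_sum.
  by apply: ler_sum => y _; exact: gentle.
have gB' : - rtr (K *m B') <= \sum_(y <- s) rtr (A' y).
  rewrite -rtrN -mulNmx mulmx_sumr rtr_sum; apply: ler_sum => y _.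
  by rewrite {2}/A' (rtr_sp1 (uU y)); apply: rtr_contractive_sp.
rewrite big_split /=.
exact: (achievability_arith m0 flat g1 tl gB gB').
Qed.

Lemma achievability_one_shot : exists2 s : seq Y, size s = M &
  trnorm (rho - toC M%:R^-1 *: \sum_(y <- s) sp (U y) (w y)) <= 5 * th.
Proof.
have /andP[th0 th1] := th01; have m0 : (0 : R) < M%:R by rewrite ltr0n.
pose k := (2 * lam * th * M%:R)^-1.
have k0 : 0 <= k by rewrite invr_ge0 !mulr_ge0 // ltW.
have [s sz hs] := greedy_codebook
  (fun y => rtr (A' y) + rtr (A y *m Pc) / (2 * th)) k q_dist Z_mean0 M.
exists s => //.
have [K cK ->] := trnorm_attained (rho - toC M%:R^-1 *: \sum_(y <- s) sp (U y) (w y)).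
rewrite -(ler_pM2l m0); apply: (le_trans (bound cK sz erefl)).
(* The total [2 th^2 + 3 th] is at most [5 th] because [th <= 1]. *)
apply: (@le_trans _ _ (M%:R * (th ^+ 2 + 2 * th) + M%:R * (th ^+ 2 + th))); last first.
  by rewrite -mulrDr; apply: ler_wpM2l; [exact: ltW|nra].
rewrite lerD2l; apply: (le_trans hs); apply: ler_wpM2l; first exact: ltW.
have -> : \sum_y q y * (rtr (A' y) + rtr (A y *m Pc) / (2 * th) + k * rtr (adj (Z y) *m Z y)) =
  \sum_y q y * rtr (A' y) + (2 * th)^-1 * (\sum_y q y * rtr (A y *m Pc)) +
  k * \sum_y q y * rtr (adj (Z y) *m Z y).
  rewrite !mulr_sumr -!big_split; apply: eq_bigr => y _ /=.
  by move: (rtr _) (rtr _) (rtr _) => a b c; ring.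
have h2 : (2 * th)^-1 * (\sum_y q y * rtr (A y *m Pc)) <= th / 2.
  have -> : th / 2 = (2 * th)^-1 * th ^+ 2 by field; rewrite gt_eqF.
  by apply: ler_wpM2l => //; rewrite invr_ge0 mulr_ge0 // ltW.
have h3 : k * \sum_y q y * rtr (adj (Z y) *m Z y) <= th / 2.
  apply: (@le_trans _ _ (k * mu)); first exact: ler_wpM2l.
  have -> : th / 2 = k * (th ^+ 2 * M%:R * lam) by rewrite /k; field; rewrite !gt_eqF.
  exact: ler_wpM2l.
have h1 := mean_A'.
move: (\sum_y _) (_ * \sum_y _) (k * _) h1 h2 h3 => a b c; lra.
Qed.

End Achievability.

(** * The distinguishing test of the converse *)

Lemma span_projection n (I : finType) (c : pred I) (u : I -> 'rV[C]_n) :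
  exists T : 'M[C]_n, [/\ adj T = T, T *m T = T, forall i, c i -> u i *m T = u i
    & rtr T <= \sum_(i | c i) 1].
Proof.
pose J := {i | c i}; pose G : 'M[C]_(#|{: J}|, n) := \matrix_k u (val (enum_val k)).
pose B := schmidt (row_base G).
have uB : B *m adj B = 1%:M.
  exact/unitarymxP/schmidt_unitarymx/rank_leq_col.
exists (adj B *m B); split.
- by rewrite adjM adjK.
- by rewrite mulmxA -(mulmxA (adj B)) uB mulmx1.
- move=> i ci; have /submxP [D ->] : (u i <= B)%MS.
    rewrite -[u i](_ : row (enum_rank (exist _ i ci : J)) G = _); last first.
      by rewrite rowK enum_rankK.
    apply: (submx_trans (row_sub _ _)); apply: submx_trans (schmidt_sub _).
    by rewrite eq_row_base.
  by rewrite mulmxA -(mulmxA D) uB mulmx1.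
- rewrite rtrC uB rtr_id sumr_const ler_nat; apply: (leq_trans (rank_leq_row G)).
  by rewrite card_sig.
Qed.

Section Sandwich.
Variables (n : nat) (P Q : 'M[C]_n).
Hypotheses (aP : adj P = P) (PP : P *m P = P) (aQ : adj Q = Q) (QQ : Q *m Q = Q).

Lemma qf_proj_le1 v : qf v P <= qf v 1%:M.
Proof.
have -> : 1%:M = P + (1%:M - P) *m adj (1%:M - P).
  by rewrite adjD adjN adj1 aP (proj_compl PP) addrC subrK.
by rewrite qfD lerDl qf_adjM_ge0.
Qed.

Lemma qf_proj_ge0 v : 0 <= qf v P.
Proof. by rewrite -PP -{2}aP qf_adjM_ge0. Qed.

(** [F = P Q P] need not be a projection, but [F - F^2 = G adj G] is nonnegative and
    [(2 F - 1)^2 = 1 - 4 (F - F^2)]. On a difference of states [2 F - 1] has twice the trace of [F],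
    which turns the test [F] into a trace-norm bound. *)
Lemma sandwich_contractive : contractive (toC 2 *: (P *m Q *m P) - 1%:M).
Proof.
move=> v; set F := P *m Q *m P; set G := P *m Q *m (1%:M - P).
have aF : adj F = F by rewrite /F !adjM aP aQ mulmxA.
have GG : G *m adj G = F - F *m F.
  have -> : adj G = (1%:M - P) *m Q *m P by rewrite /G !adjM adjD adjN adj1 aP aQ mulmxA.
  rewrite /G !mulmxA -(mulmxA (P *m Q)) (proj_compl PP) mulmxBr mulmx1 !mulmxBl.
  by rewrite -(mulmxA P Q Q) QQ /F -(mulmxA (P *m Q) P P) PP.
have := qf_adjM_ge0 v G; rewrite GG adjD adjN adjZ aF adj1.
rewrite mulmxBl mul1mx mulmxBr mulmx1 -!scalemxAl -!scalemxAr !qfD !qfN !qfD !qfN !qfZ.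
by move: (qf _ _) (qf _ _) (qf _ _) => x y z; lra.
Qed.

End Sandwich.

Section Converse.
Variables (Y : finType) (q : Y -> R) (N : nat) (U : Y -> 'M[C]_N) (w : Y -> 'I_N -> R).
Variables (V : 'M[C]_N) (r : 'I_N -> R) (L : 'M[C]_N) (g : pred 'I_N) (b : pred Y).
Variables (lam lam' eta : R) (M : nat).
Hypotheses (q_dist : is_dist q) (uU : forall y, U y *m adj (U y) = 1%:M)
  (uV : V *m adj V = 1%:M) (uL : L *m adj L = 1%:M)
  (w_dist : forall y, is_dist (w y)) (r_dist : is_dist r).
Hypotheses (lam0 : 0 <= lam) (lam'0 : 0 < lam')
  (code_size : \sum_(y | q y != 0) 1 <= M%:R :> R)
  (test_code : forall y, ~~ b y -> \sum_(i | g i) qf (row i L) (sp (U y) (w y)) <= eta)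
  (tail_code : forall y, b y -> \sum_(j | w y j < lam') w y j <= eta)
  (test_rho : \sum_(i | ~~ g i) qf (row i L) (sp V r) <= eta)
  (tail_rho : \sum_(i | lam < r i) r i <= eta).
Let P := sp L (fun i => if g i then 1 else 0).
Let sigma := \sum_y toC (q y) *: sp (U y) (w y).

Let q0 y : 0 <= q y. Proof. by case: q_dist. Qed.
Let w0 y j : 0 <= w y j. Proof. by case: (w_dist y). Qed.
Let r0 i : 0 <= r i. Proof. by case: r_dist. Qed.
Let aP : adj P = P. Proof. exact: adj_sp. Qed.
Let PP : P *m P = P.
Proof. by rewrite /P (spM uL); apply: eq_sp => i; case: ifP; rewrite ?mul1r ?mul0r. Qed.
Let PcE : 1%:M - P = sp L (fun i => if ~~ g i then 1 else 0).
Proof.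
apply/eqP; rewrite subr_eq; apply/eqP; rewrite /P spD -(sp1 uL).
by apply: eq_sp => i; case: (g i); rewrite ?addr0 ?add0r.
Qed.

Let rtr_P_sp (c : pred 'I_N) A :
  rtr (A *m sp L (fun i => if c i then 1 else 0)) = \sum_(i | c i) qf (row i L) A.
Proof.
rewrite -[sp L _]mul1mx rtr_sp mulmx1 [RHS]big_mkcond; apply: eq_bigr => i _.
by case: ifP; rewrite ?mul1r ?mul0r.
Qed.

Let c (yj : Y * 'I_N) := [&& q yj.1 != 0, b yj.1 & lam' <= w yj.1 yj.2].

(** The eigenvalues of a codeword sum to one, so at most [1 / lam'] of them reach [lam']. *)
Let card_c : \sum_(yj | c yj) 1 <= M%:R / lam'.
Proof.
rewrite ler_pdivlMr // mulr_suml.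
apply: (@le_trans _ _ (\sum_(yj : Y * 'I_N | q yj.1 != 0) w yj.1 yj.2)).
  rewrite big_mkcond [leRHS]big_mkcond; apply: ler_sum => -[y j] _; rewrite /c /=.
  by case: (q y != 0) => //=; case: (b y) => //=; case: ifP; rewrite ?mul1r.
rewrite (eq_bigl (fun p : Y * 'I_N => (q p.1 != 0) && xpredT p.2)); last first.
  by move=> p; rewrite andbT.
rewrite -(pair_big (fun y => q y != 0) xpredT (fun y j => w y j)) /=.
by rewrite (eq_bigr (fun=> 1)) // => y _; case: (w_dist y).
Qed.

(* The test accepts [P (1 - T) P] as evidence for [rho]: [1 - P] detects the
   codewords outside [b], and [T] projects onto the [P]-images of the at most
   [M / lam'] eigenvectors carrying almost all the weight of the codewords in [b]. *)
Lemma converse_one_shot :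
  1 - trnorm (sp V r - sigma) / 2 <= 3 * eta + lam * M%:R / lam'.
Proof.
have [T [aT TT uT rT]] := span_projection c (fun yj => row yj.2 (U yj.1) *m P).
pose Q : 'M[C]_N := 1%:M - T.
have aQ : adj Q = Q by rewrite /Q adjD adjN adj1 aT.
have QQ : Q *m Q = Q by exact: proj_compl.
pose F := P *m Q *m P.
have qF v : qf v F = qf (v *m P) Q by rewrite -qf_congr aP.
have F0 v : 0 <= qf v F by rewrite qF qf_proj_ge0.
have FP v : qf v F <= qf v P.
  have PE : P = P *m 1%:M *m adj P by rewrite mulmx1 aP PP.
  by rewrite qF [X in _ <= qf _ X]PE qf_congr qf_proj_le1.
have F1 v : qf v F <= qf v 1%:M by apply: (le_trans (FP v)); exact: qf_proj_le1.
have hs : rtr (F *m sigma) <= eta.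
  rewrite mulmx_sumr rtr_sum -[eta]mul1r -q_dist.2 mulr_suml; apply: ler_sum => y _.
  rewrite -scalemxAr rtrZ; have [->|qy] := eqVneq (q y) 0; first by rewrite !mul0r.
  apply: ler_wpM2l => //; case: (boolP (b y)) => by_.
    rewrite -[sp _ _]mul1mx rtr_sp mulmx1; apply: le_trans (tail_code by_).
    rewrite [leRHS]big_mkcond; apply: ler_sum => j _; case: ifPn => h.
      by rewrite ler_piMr // -(qf_row (uU y) j) F1.
    have -> : qf (row j (U y)) F = 0; last by rewrite mulr0.
    (* [T] fixes the [P]-image of a kept eigenvector, so [Q] annihilates it. *)
    have uPT : row j (U y) *m P *m T = row j (U y) *m P.
      by apply: (uT (y, j)); rewrite /c /= qy by_ leNgt.
    have TE : T = T *m 1%:M *m adj T by rewrite mulmx1 aT TT.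
    by rewrite qF /Q qfD qfN [X in _ - qf _ X]TE qf_congr uPT subrr.
  apply: le_trans (test_code by_); rewrite -rtr_P_sp -/P rtrC.
  rewrite -[sp _ _]mul1mx !rtr_sp !mulmx1; apply: ler_sum => j _.
  exact: ler_wpM2l.
have hr : rtr ((1%:M - F) *m sp V r) <= 2 * eta + lam * M%:R / lam'.
  have -> : 1%:M - F = (1%:M - P) + P *m T *m P.
    rewrite /F /Q mulmxBr mulmx1 mulmxBl PP opprB addrA addrAC; congr (_ + _).
  rewrite mulmxDl rtrD PcE rtrC rtr_P_sp (_ : 2 * eta = eta + eta); last by ring.
  rewrite -addrA; apply: lerD => //.
  (* Eigenvalues of [rho] above [lam] are charged in full; the others contribute at most [lam] times
     the trace of [T]. *)
  apply: (@le_trans _ _ (\sum_(i | lam < r i) r i + lam * rtr T)); last first.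
    by apply: lerD => //; rewrite -mulrA; apply: ler_wpM2l => //; exact: le_trans card_c.
  have PTP v : 0 <= qf v (P *m T *m P) <= qf v 1%:M.
    have -> : qf v (P *m T *m P) = qf (v *m P) T by rewrite -qf_congr aP.
    rewrite qf_proj_ge0 //=; apply: (le_trans (qf_proj_le1 aT TT _)).
    by rewrite -qf_congr mulmx1 aP PP qf_proj_le1.
  have -> : rtr T = rtr (T *m P *m T) + rtr (T *m (1%:M - P) *m T).
    by rewrite -rtrD -mulmxDl -mulmxDr addrC subrK mulmx1 TT.
  have h1 : rtr (T *m P *m T) = \sum_i qf (row i V) (P *m T *m P).
    rewrite -{1}PP mulmxA -(mulmxA (T *m P)) rtrC mulmxA -(mulmxA P T T) TT.
    rewrite -[X in rtr X]mulmx1 -[1%:M]mul1mx -{2}(sp1 uV) rtr_sp.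
    by apply: eq_bigr => i _; rewrite mul1r mulmx1.
  have h2 : 0 <= rtr (T *m (1%:M - P) *m T).
    have -> : T *m (1%:M - P) *m T = (T *m (1%:M - P)) *m adj (T *m (1%:M - P)).
      rewrite adjM adjD adjN adj1 aT aP !mulmxA -(mulmxA T (1%:M - P) (1%:M - P)).
      by rewrite (proj_compl PP).
    by rewrite -{1}[_ *m (1%:M - P)]adjK rtr_adjM_ge0.
  apply: (@le_trans _ _ (\sum_(i | lam < r i) r i + lam * \sum_i qf (row i V) (P *m T *m P))).
    rewrite -[sp V r]mul1mx rtr_sp mulmx1 mulr_sumr [X in _ <= X + _]big_mkcond -big_split.
    apply: ler_sum => i _; have /andP[p0 p1] := PTP (row i V); rewrite (qf_row uV) in p1.
    case: ifPn => /= h; last by rewrite add0r ler_wpM2r // leNgt.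
    by rewrite (@le_trans _ _ (r i)) ?ler_piMr // lerDl mulr_ge0.
  by rewrite lerD2l -h1; apply: ler_wpM2l => //; rewrite lerDl.
have := trnorm_ge (sp V r - sigma) (sandwich_contractive aP PP aQ QQ); rewrite -/F.
move: hr; rewrite mulmxBl mul1mx rtrB (rtr_sp1 uV) r_dist.2.
rewrite mulmxBl mul1mx -scalemxAl rtrB rtrZ mulmxBr !rtrB (rtr_sp1 uV) r_dist.2.
have -> : rtr sigma = 1.
  rewrite rtr_sum -q_dist.2; apply: eq_bigr => y _.
  by rewrite rtrZ (rtr_sp1 (uU y)) (w_dist y).2 mulr1.
move: hs; move: (rtr _) (rtr _) (trnorm _) (_ / lam') => x y z t; lra.
Qed.

End Converse.

End OneShot.

(** * Tensor powers and mutual information *)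

Section Tensor.
Variable R : realType.
Local Notation C := R[i].
Local Notation Re := (@complex.Re R).

Transparent mulmx adj sp.

Lemma sum_tidx n d (F : {ffun 'I_n -> 'I_d} -> R) (c : pred {ffun 'I_n -> 'I_d}) :
  \sum_(i < tdim n d | c (tidx i)) F (tidx i) = \sum_(f | c f) F f.
Proof.
rewrite [RHS](reindex (@enum_val {ffun 'I_n -> 'I_d} predT)) //.
exact/onW_bij/enum_val_bij.
Qed.

Lemma tensM n d (A B : 'I_n -> 'M[C]_d) :
  tensmxn A *m tensmxn B = tensmxn (fun k => A k *m B k).
Proof.
apply/matrixP => i j; rewrite !mxE.
rewrite [RHS](eq_bigr (fun k => \sum_l A k (tidx i k) l * B k l (tidx j k))); last first.
  by move=> k _; rewrite mxE.
rewrite bigA_distr_bigA /= (reindex (@enum_val {ffun 'I_n -> 'I_d} predT)) /=; last first.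
  exact/onW_bij/enum_val_bij.
by apply: eq_bigr => l _; rewrite !mxE -big_split.
Qed.

Lemma adj_tens n d (A : 'I_n -> 'M[C]_d) : adj (tensmxn A) = tensmxn (fun k => adj (A k)).
Proof.
apply/matrixP => i j; rewrite !mxE rmorph_prod.
by apply: eq_bigr => k _; rewrite !mxE.
Qed.

Lemma tens_sdiag n d (w : 'I_n -> 'I_d -> R) :
  tensmxn (fun k => sdiag (w k)) = sdiag (fun i => \prod_k w k (tidx i k)).
Proof.
apply/matrixP => i j; rewrite !mxE; have [->|ij] := eqVneq i j.
  by rewrite toC_prod mulr1n; apply: eq_bigr => k _; rewrite !mxE eqxx mulr1n.
have [k hk] : exists k, tidx i k != tidx j k.
  apply/existsP; apply: contraNT ij; rewrite negb_exists => /forallP h.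
  apply/eqP/enum_val_inj/ffunP => k; apply/eqP; have := h k; rewrite negbK; exact.
by rewrite mulr0n (bigD1 k) //= !mxE (negPf hk) mulr0n mul0r.
Qed.

Lemma tens1 n d : tensmxn (fun _ : 'I_n => 1%:M : 'M[C]_d) = 1%:M.
Proof.
have sd1 m : sdiag (fun _ : 'I_m => 1) = 1%:M :> 'M[C]_m.
  by apply/matrixP => i j; rewrite !mxE.
rewrite -(sd1 d) tens_sdiag -sd1; congr sdiag; apply/funext => i.
by rewrite big1.
Qed.

Lemma tens_sp n d (U : 'I_n -> 'M[C]_d) w :
  tensmxn (fun k => sp (U k) (w k)) = sp (tensmxn U) (fun i => \prod_k w k (tidx i k)).
Proof. by rewrite /sp -tens_sdiag adj_tens !tensM. Qed.

Lemma tens_unitary n d (U : 'I_n -> 'M[C]_d) : (forall k, U k *m adj (U k) = 1%:M) ->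
  tensmxn U *m adj (tensmxn U) = 1%:M.
Proof.
move=> h; rewrite adj_tens tensM -[RHS](@tens1 n d); congr tensmxn.
by apply/funext => k; exact: h.
Qed.

Transparent qf.

(** [qf] keeps only a real part, which is not multiplicative. Hermitian diagonal entries are real,
    so nothing is lost when factors are multiplied in [qf_tens]. *)
Lemma diag_qf d (L A : 'M[C]_d) i : adj A = A -> (L *m A *m adj L) i i = toC (qf (row i L) A).
Proof.
move=> hA; have rowE : (L *m A *m adj L) i i = (row i L *m A *m adj (row i L)) 0 0.
  rewrite -row_mul [LHS]mxE [RHS]mxE; apply: eq_bigr => k _.
  by rewrite [row _ _ _ _]mxE; congr (_ * _); rewrite !mxE.
rewrite rowE /qf -rowE.
have : adj (L *m A *m adj L) i i = (L *m A *m adj L) i i by rewrite !adjM adjK hA mulmxA.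
rewrite [adj _ i i]mxE [_^T _ _]mxE; case: ((L *m A *m adj L) i i) => x y /= [yy].
by rewrite /toC; congr Complex; lra.
Qed.

Lemma qf_tens n d (L A : 'I_n -> 'M[C]_d) i : (forall k, adj (A k) = A k) ->
  qf (row i (tensmxn L)) (tensmxn A) = \prod_k qf (row (tidx i k) (L k)) (A k).
Proof.
move=> hA; suff : toC (qf (row i (tensmxn L)) (tensmxn A)) =
    toC (\prod_k qf (row (tidx i k) (L k)) (A k)) by case.
rewrite -diag_qf; last by rewrite adj_tens; congr tensmxn; apply/funext.
rewrite adj_tens !tensM mxE toC_prod; apply: eq_bigr => k _.
by rewrite diag_qf.
Qed.

Lemma Wnmix_iid (X : finType) d (W : X -> 'M[C]_d) (p : X -> R) n :
  Wnmix W (@iid R X p n) = tensmxn (fun _ => Wmix W p).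
Proof.
apply/matrixP => i j; rewrite /Wnmix summxE mxE.
rewrite [RHS](eq_bigr (fun k => \sum_x toC (p x) * W x (tidx i k) (tidx j k))); last first.
  by move=> k _; rewrite /Wmix summxE; apply: eq_bigr => x _; rewrite mxE.
rewrite bigA_distr_bigA; apply: eq_bigr => f _.
by rewrite !mxE /iid toC_prod -big_split.
Qed.

Lemma hermsymmx_adj d (A : 'M[C]_d) : A \is hermsymmx -> adj A = A.
Proof. by move=> /is_hermitianmxP; rewrite expr0 scale1r => e; exact: esym e. Qed.

Transparent rtr.

Lemma state_rtr d (A : 'M[C]_d) : is_state A -> rtr A = 1.
Proof. by case=> _ [_]; rewrite /rtr => ->. Qed.

Lemma Re_tr d (A : 'M[C]_d) : Re (\tr A) = rtr A.
Proof. by []. Qed.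

Opaque mulmx adj sp qf rtr.

Definition eig d (A : 'M[C]_d) (i : 'I_d) : R := Re (spectral_diag A 0 i).

Lemma state_adj d (A : 'M[C]_d) : is_state A -> adj A = A.
Proof. by case=> /hermsymmx_adj. Qed.

Lemma state_sp d (A : 'M[C]_d) : is_state A -> A = sp (spectralmx A) (eig A).
Proof. by move=> /state_adj; exact: hermsym_sp. Qed.

Lemma state_qf_ge0 d (A : 'M[C]_d) v : is_state A -> 0 <= qf v A.
Proof. by case=> _ [/(_ v) + _]; rewrite lecE => /andP[]. Qed.

Lemma sum_qf_row d (U A : 'M[C]_d) : U *m adj U = 1%:M -> \sum_i qf (row i U) A = rtr A.
Proof.
move=> uU; rewrite -[A in RHS]mulmx1 -[1%:M]mul1mx -{2}(sp1 uU) rtr_sp.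
by apply: eq_bigr => i _; rewrite mul1r mulmx1.
Qed.

Lemma qf_row_dist d (U A : 'M[C]_d) : U *m adj U = 1%:M -> is_state A ->
  is_dist (fun i => qf (row i U) A).
Proof.
move=> uU sA; split=> [i|]; first exact: state_qf_ge0.
by rewrite sum_qf_row // state_rtr.
Qed.

Lemma eig_qf d (A : 'M[C]_d) i : is_state A -> eig A i = qf (row i (spectralmx A)) A.
Proof.
by move=> sA; have := qf_row_sp (spectral_unitary A) i (eig A); rewrite -state_sp.
Qed.

Lemma eig_dist d (A : 'M[C]_d) : is_state A -> is_dist (eig A).
Proof.
move=> sA; have [h0 h1] := qf_row_dist (spectral_unitary A) sA.
by split=> [i|]; [rewrite eig_qf|rewrite -h1; apply: eq_bigr => i _; rewrite eig_qf].
Qed.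

Lemma Wmix_state (X : finType) d (W : X -> 'M[C]_d) (q : X -> R) :
  (forall x, is_state (W x)) -> is_dist q -> is_state (Wmix W q).
Proof.
move=> sW [q0 q1]; split; [|split].
- apply/is_hermitianmxP; rewrite expr0 scale1r.
  rewrite -[RHS]/(adj _) /Wmix adj_sum; apply: eq_bigr => x _.
  by rewrite adjZ state_adj.
- move=> v; rewrite /Wmix mulmx_sumr mulmx_suml summxE; apply: sumr_ge0 => x _.
  rewrite -scalemxAr -scalemxAl mxE mulr_ge0 //; first by rewrite ler0c.
  by case: (sW x) => _ [].
- rewrite /Wmix raddf_sum /= (eq_bigr (fun x => toC (q x))).
    by rewrite -toC_sum q1.
  by move=> x _; rewrite mxtraceZ; case: (sW x) => _ [_ ->]; rewrite mulr1.
Qed.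

Lemma rtr_sp_fun d (A : 'M[C]_d) (f : R -> R) : is_state A ->
  rtr (A *m sp (spectralmx A) (fun i => f (eig A i))) = \sum_i eig A i * f (eig A i).
Proof.
move=> sA; rewrite [X in rtr (X *m _)](state_sp sA) (spM (spectral_unitary A)).
by rewrite (rtr_sp1 (spectral_unitary A)).
Qed.

Lemma mxlog2_sp d (A : 'M[C]_d) : is_state A ->
  mxlog2 A = sp (spectralmx A) (fun i => ln (eig A i) / ln 2).
Proof.
move=> sA; rewrite /mxlog2 mxfun_sp; apply: eq_sp => i; rewrite -/(eig A i).
case: ltP => // h; have := (eig_dist sA).1 i => h0.
by rewrite ln0 ?mul0r.
Qed.

Lemma rtr_mxlog2 d (A : 'M[C]_d) : is_state A -> rtr (A *m mxlog2 A) = - entropy (eig A) / ln 2.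
Proof.
move=> sA; rewrite mxlog2_sp // (rtr_sp_fun (fun x => ln x / ln 2) sA) opprK mulr_suml.
by apply: eq_bigr => i _; rewrite mulrA.
Qed.

Section MutualInformation.
Variables (X : finType) (d : nat) (W : X -> 'M[C]_d) (q : X -> R).
Hypotheses (sW : forall x, is_state (W x)) (q_dist : is_dist q).
Let rho := Wmix W q.
Let srho : is_state rho. Proof. exact: Wmix_state. Qed.
Let q0 x : 0 <= q x. Proof. by case: q_dist. Qed.

Let qf_rho v : qf v rho = \sum_x q x * qf v (W x).
Proof. by rewrite /rho /Wmix qf_sum; apply: eq_bigr => x _; rewrite qfZ. Qed.

Let qf_rho0 v x : q x != 0 -> qf v rho = 0 -> qf v (W x) = 0.
Proof.
move=> qx /eqP; rewrite qf_rho psumr_eq0; last first.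
  by move=> y _; rewrite mulr_ge0 // state_qf_ge0.
by move=> /allP /(_ x (mem_index_enum _)); rewrite mulf_eq0 (negPf qx) => /eqP.
Qed.

(** A vanishing quadratic form of the mixture vanishes on every component of positive weight, and a
    root [S] of [W x] turns this into [v S = 0]. It puts [relent] in its finite branch. *)
Let supp x : q x != 0 -> forall v : 'rV[C]_d, v *m rho = 0 -> v *m W x = 0.
Proof.
move=> qx v vr; have : qf v (W x) = 0.
  by apply: qf_rho0 => //; rewrite qfE vr mul0mx rtr0.
have [S aS ->] : exists2 S, adj S = S & W x = S *m S.
  rewrite (state_sp (sW x)); apply: sp_sqrt; first exact: spectral_unitary.
  by case: (eig_dist (sW x)).
rewrite qfE -{2}aS !mulmxA -mulmxA -adjM -{1}[v *m S]adjK => /rtr_adjM_eq0 h.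
by rewrite -[v *m S]adjK h adj0 mul0mx.
Qed.

Lemma mutinfE : mutinf W q =
  ((entropy (eig rho) - \sum_x q x * entropy (eig (W x))) / ln 2)%:E.
Proof.
rewrite /mutinf -/rho.
rewrite (eq_bigr (fun x => (q x * (rtr (W x *m mxlog2 (W x)) - rtr (W x *m mxlog2 rho)))%:E)).
  rewrite sumEFin; congr EFin.
  under eq_bigr do rewrite mulrBr.
  have H : \sum_x q x * rtr (W x *m mxlog2 rho) = rtr (rho *m mxlog2 rho).
    rewrite {2}/rho /Wmix mulmx_suml rtr_sum; apply: eq_bigr => x _.
    by rewrite -scalemxAl rtrZ.
  rewrite sumrB [X in _ - X]H rtr_mxlog2 // mulrBl addrC mulNr opprK; congr (_ + _).
  rewrite mulr_suml -sumrN; apply: eq_bigr => x _.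
  by rewrite rtr_mxlog2 // mulNr mulrN mulrA.
move=> x _; have [->|qx] := eqVneq (q x) 0; first by rewrite mul0e mul0r.
rewrite /relent; case: asboolP => [_|]; last by move=> []; exact: supp.
by rewrite Re_tr mulmxBr rtrB -EFinM.
Qed.

(* Klein's inequality through the doubly stochastic matrix [D] of squared
   overlaps between the two eigenbases. *)
Let klein x : q x != 0 ->
  entropy (eig (W x)) <= - \sum_i qf (row i (spectralmx rho)) (W x) * ln (eig rho i).
Proof.
move=> qx; set U := spectralmx (W x); set V := spectralmx rho.
have uU : U *m adj U = 1%:M := spectral_unitary _.
have uV : V *m adj V = 1%:M := spectral_unitary _.
pose D (i j : 'I_d) := qf (row j U) (adj (row i V) *m row i V).
have qD v w : qf v (sp U w) = \sum_j w j * qf (row j U) (adj v *m v).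
  by rewrite qfE rtrC rtr_sp.
have D0 i j : 0 <= D i j by rewrite /D -{2}[row i V]adjK qf_adjM_ge0.
have [w0 w1] := eig_dist (sW x); have [r0 r1] := eig_dist srho.
have WD i : qf (row i V) (W x) = \sum_j eig (W x) j * D i j.
  by rewrite [in LHS](state_sp (sW x)) -/U qD.
have Drow i : \sum_j D i j = 1.
  rewrite -(qf_row uV i) -(sp1 uU) qD; apply: eq_bigr => j _.
  by rewrite mul1r.
have Dcol j : \sum_i D i j = 1.
  rewrite -(qf_row uU j) qfE mulmx1 rtrC -(sum_qf_row _ uV); apply: eq_bigr => i _.
  by rewrite /D !qfE !mulmxA -mulmxA rtrC !mulmxA.
rewrite /entropy lerN2.
have -> : \sum_i qf (row i V) (W x) * ln (eig rho i) =
    \sum_i \sum_j D i j * (eig (W x) j * ln (eig rho i)).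
  by apply: eq_bigr => i _; rewrite WD mulr_suml; apply: eq_bigr => j _; ring.
have -> : \sum_j eig (W x) j * ln (eig (W x) j) =
    \sum_i \sum_j D i j * (eig (W x) j * ln (eig (W x) j)).
  by rewrite exchange_big; apply: eq_bigr => j _ /=; rewrite -mulr_suml Dcol mul1r.
(* Adding this zero sum reduces the claim to the termwise bound [w ln r + w - r <= w ln w], that is,
   [ln z <= z - 1] at [z = r / w]. *)
have Z : \sum_i \sum_j D i j * (eig (W x) j - eig rho i) = 0.
  under eq_bigr do under eq_bigr do rewrite mulrBr.
  under eq_bigr do rewrite sumrB.
  rewrite sumrB exchange_big /=.
  under eq_bigr do rewrite -mulr_suml Dcol mul1r.
  rewrite w1; under eq_bigr do rewrite -mulr_suml Drow mul1r.
  by rewrite r1 subrr.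
rewrite -[leLHS]addr0 -[X in _ + X]Z -big_split /=; apply: ler_sum => i _.
rewrite -big_split /=; apply: ler_sum => j _.
rewrite -mulrDr; have := w0 j; rewrite le_eqVlt => /predU1P[<-|wj].
  by rewrite !mul0r mulr0 add0r sub0r mulr_ge0_le0 // oppr_le0.
(* If [eig rho i] vanishes while [eig (W x) j] is positive, the support inclusion makes the overlap
   [D i j] zero. *)
have := r0 i; rewrite le_eqVlt => /predU1P[ri|ri].
  have : qf (row i V) (W x) = 0 by apply: qf_rho0 => //; rewrite -eig_qf.
  move=> /eqP; rewrite WD psumr_eq0; last by move=> k _; rewrite mulr_ge0.
  move=> /allP /(_ j (mem_index_enum _)); rewrite mulf_eq0 gt_eqF //= => /eqP ->.
  by rewrite !mul0r.
apply: ler_wpM2l => //.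
have : ln (eig rho i / eig (W x) j) <= eig rho i / eig (W x) j - 1.
  by have := expR_ge1Dx (ln (eig rho i / eig (W x) j)); rewrite lnK ?posrE ?divr_gt0 //; lra.
rewrite ln_div ?posrE // => h.
have := ler_wpM2l (ltW wj) h.
rewrite mulrBr mulrBr mulr1 mulrCA divff ?gt_eqF // mulr1; lra.
Qed.

Lemma entropy_concave : \sum_x q x * entropy (eig (W x)) <= entropy (eig rho).
Proof.
rewrite /(entropy (eig rho)).
have -> : \sum_i eig rho i * ln (eig rho i) =
   \sum_x q x * \sum_i qf (row i (spectralmx rho)) (W x) * ln (eig rho i).
  under [RHS]eq_bigr do rewrite mulr_sumr.
  rewrite exchange_big; apply: eq_bigr => i _ /=.
  by rewrite eig_qf // qf_rho mulr_suml; apply: eq_bigr => x _; rewrite mulrA.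
rewrite -sumrN; apply: ler_sum => x _; rewrite -mulrN.
have [->|qx] := eqVneq (q x) 0; first by rewrite !mul0r.
by apply: ler_wpM2l => //; exact: klein.
Qed.

End MutualInformation.
End Tensor.

(** * Exponents *)

Section Asymptotics.
Variables (R : realType) (X : finType) (d : nat) (W : X -> 'M[R[i]]_d) (p : X -> R).
Local Notation C := R[i].
Hypotheses (sW : forall x, is_state (W x)) (p_dist : is_dist p).
Let rho := Wmix W p.
Let H x := entropy (eig (W x)).
Let Hrho := entropy (eig rho).
Let srho : is_state rho. Proof. exact: Wmix_state. Qed.

Lemma rtr_mulWmix (A : 'M[C]_d) (y : X -> R) :
  rtr (A *m Wmix W y) = \sum_z y z * rtr (A *m W z).
Proof.
rewrite /Wmix mulmx_sumr rtr_sum; apply: eq_bigr => z _.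
by rewrite -scalemxAr rtrZ.
Qed.

Lemma adj_Wmix (y : X -> R) : adj (Wmix W y) = Wmix W y.
Proof.
by rewrite /Wmix adj_sum; apply: eq_bigr => z _; rewrite adjZ state_adj.
Qed.

Lemma WmixB (y z : X -> R) : Wmix W y - Wmix W z = Wmix W (fun x => y x - z x).
Proof.
by rewrite /Wmix -sumrB; apply: eq_bigr => x _; rewrite toCD toCN scalerBl.
Qed.

(* Strong duality for the linear program that maximizes the mean output entropy
   under [Wmix W q = rho]; dual variables in the real span of the [W z] suffice,
   because the residual [Wmix W q - rho] lies in that span. *)
Lemma dual_operator (h : R) :
  (forall q, is_dist q -> Wmix W q = rho -> \sum_x q x * H x < h) ->
  exists2 L : 'M[C]_d, adj L = L &
    (forall x, H x <= rtr (W x *m L)) /\ rtr (rho *m L) < h.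
Proof.
move=> feas; apply: contrapT => nodual.
(* A pair [(y, s)] with [s > 0] encodes the candidate [L = - (1 / s) \sum_z y z W z]: [f <= 0] is
   the entropy constraint on [L], and [g > 0] says that [rtr (rho L) < h]. Homogenizing makes both
   linear, as Farkas requires. *)
pose V := ({ffun X -> R^o} * R^o)%type.
pose G x (y : {ffun X -> R^o}) : R := \sum_z y z * rtr (W x *m W z).
pose f (i : 'I_#|X|) (v : V) : R := G (enum_val i) v.1 + v.2 * H (enum_val i).
pose g (v : V) : R := \sum_z v.1 z * rtr (rho *m W z) + v.2 * h.
have sumL (F : X -> R) (a : R) (y y' : {ffun X -> R^o}) :
    \sum_z (a *: y + y') z * F z = a * (\sum_z y z * F z) + \sum_z y' z * F z.
  rewrite mulr_sumr -big_split; apply: eq_bigr => z _ /=.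
  by rewrite !ffunE mulrDl mulrA.
have [||v hv|c c0 hc] := @farkas R V #|X| f g.
- by move=> i a v v'; rewrite /f /G /= sumL /GRing.scale /=; ring.
- by move=> a v v'; rewrite /g /= sumL /GRing.scale /=; ring.
- rewrite leNgt; apply/negP => gv; apply: nodual.
  have hx x : G x v.1 + v.2 * H x <= 0 by have := hv (enum_rank x); rewrite /f enum_rankK.
  (* [p] is itself feasible; averaging the constraints under [p] forces the homogenizing coordinate
     to be positive. *)
  have hp := feas p p_dist erefl.
  have E : \sum_x p x * (G x v.1 + v.2 * H x) =
      \sum_z v.1 z * rtr (rho *m W z) + v.2 * \sum_x p x * H x.
    under eq_bigr do rewrite mulrDr.
    rewrite big_split mulr_sumr /=; congr (_ + _); last by apply: eq_bigr => x _; ring.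
    rewrite /G; under eq_bigr do rewrite mulr_sumr.
    rewrite exchange_big; apply: eq_bigr => z _ /=; rewrite rtrC rtr_mulWmix mulr_sumr.
    by apply: eq_bigr => x _; rewrite (rtrC (W z)); ring.
  have le0 : \sum_z v.1 z * rtr (rho *m W z) + v.2 * \sum_x p x * H x <= 0.
    by rewrite -E; apply: sumr_le0 => x _; apply: mulr_ge0_le0; [case: p_dist|].
  have v2 : 0 < v.2.
    rewrite /g in gv; rewrite ltNge; apply/negP => v2.
    have : v.2 * (h - \sum_x p x * H x) <= 0 by apply: mulr_le0_ge0 => //; lra.
    by rewrite mulrBr; move: gv le0; move: (\sum_z _) (_ * \sum_x _) => a b; lra.
  have LE (A : 'M[C]_d) : rtr (A *m Wmix W (fun z => - v.1 z / v.2)) =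
     - (\sum_z v.1 z * rtr (A *m W z)) / v.2.
    by rewrite rtr_mulWmix -sumrN mulr_suml; apply: eq_bigr => z _; ring.
  exists (Wmix W (fun z => - v.1 z / v.2)); first exact: adj_Wmix.
  split=> [x|].
    by rewrite LE ler_pdivlMr //; have := hx x; rewrite /G; lra.
  by rewrite LE ltr_pdivrMr //; move: gv; rewrite /g; lra.
(* The multipliers form a feasible distribution whose mean entropy is exactly [h], which contradicts
   [feas]. Its equations come from evaluating at an indicator and at [(0, 1)], its normalization
   from the trace of [Wmix W q = rho]. *)
pose q x := c (enum_rank x).
have hcq v : g v = \sum_x q x * (G x v.1 + v.2 * H x).
  rewrite hc [RHS](reindex (@enum_val X predT)) /=; last exact/onW_bij/enum_val_bij.
  by apply: eq_bigr => i _; rewrite /q enum_valK.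
have hcW z : rtr (rho *m W z) = \sum_x q x * rtr (W x *m W z).
  have := hcq ([ffun t => (t == z)%:R], 0).
  have dl (F : X -> R) : \sum_t [ffun t => (t == z)%:R : R^o] t * F t = F z.
    rewrite (bigD1 z) //= ffunE eqxx mul1r big1 ?addr0 // => t tz.
    by rewrite ffunE (negPf tz) mul0r.
  rewrite /g /= dl mul0r addr0 => ->; apply: eq_bigr => x _.
  by rewrite /G dl mul0r addr0.
have hcH : h = \sum_x q x * H x.
  have := hcq (0, 1); rewrite /g /= mul1r big1 ?add0r; last by move=> z _; rewrite ffunE mul0r.
  move=> ->; apply: eq_bigr => x _; rewrite /G big1 ?add0r ?mul1r // => z _.
  by rewrite ffunE mul0r.
have qrho : Wmix W q = rho.
  apply/eqP; rewrite -subr_eq0; apply/eqP/rtr_adjM_eq0.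
  rewrite WmixB adj_Wmix rtr_mulWmix big1 // => z _.
  rewrite -WmixB mulmxBl rtrB hcW rtrC rtr_mulWmix.
  by rewrite (eq_bigr (fun x => q x * rtr (W x *m W z))) ?subrr ?mulr0 // => x _; rewrite rtrC.
have : is_dist q.
  split=> [x|]; first exact: c0.
  rewrite -(state_rtr srho) -qrho -[Wmix W q]mul1mx rtr_mulWmix.
  by apply: eq_bigr => x _; rewrite mul1mx state_rtr // mulr1.
by move=> /feas /(_ qrho); rewrite -hcH ltxx.
Qed.

Lemma prod_dist n (J : finType) (m : 'I_n -> J -> R) : (forall k, is_dist (m k)) ->
  is_dist (fun j : {ffun 'I_n -> J} => \prod_k m k (j k)).
Proof.
move=> hm; split=> [j|]; first by apply: prodr_ge0 => k _; case: (hm k).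
by rewrite (sum_ffun_prod m) big1 // => k _; case: (hm k).
Qed.

Lemma tidx_dist n (m : 'I_n -> 'I_d -> R) : (forall k, is_dist (m k)) ->
  is_dist (fun i : 'I_(tdim n d) => \prod_k m k (tidx i k)).
Proof.
move=> hm; have [h0 h1] := prod_dist hm; split=> [i|]; first exact: h0.
by rewrite -[RHS]h1 -(sum_tidx (fun j : {ffun 'I_n -> 'I_d} => \prod_k m k (j k)) xpredT).
Qed.

Lemma Wn_sp n (y : {ffun 'I_n -> X}) :
  Wn W y = sp (tensmxn (fun k => spectralmx (W (y k)))) (fun i => \prod_k eig (W (y k)) (tidx i k)).
Proof.
rewrite -(tens_sp (fun k => spectralmx (W (y k))) (fun k => eig (W (y k)))) /Wn; congr tensmxn; apply/funext => k; exact: state_sp.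
Qed.

Lemma iid_sp n : Wnmix W (@iid R X p n) =
  sp (tensmxn (fun _ => spectralmx rho)) (fun i => \prod_(k < n) eig rho (tidx i k)).
Proof.
rewrite Wnmix_iid -(tens_sp (fun=> spectralmx rho) (fun=> eig rho)); congr tensmxn; apply/funext => k; exact: state_sp.
Qed.

(** A nonzero mass is a positive multiple of [1 / M]. *)
Lemma PM_support n M (q : {ffun 'I_n -> X} -> R) : PM M q -> (0 < M)%N ->
  \sum_(y | q y != 0) 1 <= M%:R :> R.
Proof.
move=> [[q0 q1] qM] M0; have -> : (M%:R : R) = \sum_y M%:R * q y by rewrite -mulr_sumr q1 mulr1.
rewrite big_mkcond; apply: ler_sum => y _; have [k hk] := qM y.
case: ifPn => [qy|_]; last by rewrite hk.
rewrite hk ler1n lt0n; apply: contra qy => /eqP k0.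
by move: hk => /eqP; rewrite k0 mulf_eq0 pnatr_eq0 -[M == 0%N]negbK -lt0n M0.
Qed.

Lemma converse_exponent (r : R) :
  (forall q, is_dist q -> Wmix W q = rho -> \sum_x q x * H x < Hrho - r) ->
  exists2 k, 0 < k & forall n M (q : {ffun 'I_n -> X} -> R), (0 < M)%N -> PM M q ->
    M%:R <= expR (n%:R * r) ->
    1 - trnorm (Wnmix W (@iid R X p n) - Wnmix W q) / 2 <= 4 * expR (- (k * n%:R)).
Proof.
move=> /dual_operator [L aL [HL]]; set t := rtr (rho *m L) => tlt.
(* Per letter, the measurement of [L] is cut at [t + 2 de], word entropy at [t + 4 de], codeword
   eigenvalues at exponent [t + 6 de] and those of [rho] at [Hrho - 2 de]. Each comparison has
   margin [2 de], of which the moment bound uses [de]; the counting term keeps [9 - 8 = 1] share. *)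
pose de := (Hrho - r - t) / 9; have de0 : 0 < de by apply: divr_gt0 => //; lra.
have gap : Hrho - r - t = 9 * de by rewrite /de; field.
pose V := spectralmx L; pose l := eig L.
have LE : L = sp V l := hermsym_sp aL.
have uV : V *m adj V = 1%:M := spectral_unitary L.
pose m A (j : 'I_d) := qf (row j V) A.
have mean A : \sum_j m A j * l j = rtr (A *m L).
  by rewrite LE -[sp V l]mul1mx rtr_sp mulmx1; apply: eq_bigr => j _; rewrite mulrC.
have mW x : is_dist (m (W x)) by exact: qf_row_dist.
have mrho : is_dist (m rho) by exact: qf_row_dist.
have wW x : is_dist (eig (W x)) by exact: eig_dist.
have wrho : is_dist (eig rho) by exact: eig_dist.
have [s1 s10 h1] := mgf_uniform (fun _ j => - l j) mW de0.
have [s2 s20 h2] := mgf_uniform (fun (_ : unit) j => l j) (fun=> mrho) de0.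
have [s3 s30 h3] := mgf_uniform (fun x j => - ln (eig (W x) j)) wW de0.
have [s4 s40 h4] := mgf_uniform (fun (_ : unit) j => ln (eig rho j)) (fun=> wrho) de0.
pose s := Num.min (Num.min s1 s2) (Num.min s3 s4).
have s0 : 0 < s by rewrite !lt_min s10 s20 s30.
have [ss1 ss2 ss3 ss4] : [/\ 0 < s <= s1, 0 < s <= s2, 0 < s <= s3 & 0 < s <= s4].
  by split; rewrite s0 /s !ge_min lexx ?orbT.
(* [s * de] serves the four tails, [de] the counting term. *)
pose k := Num.min (s * de) de.
have k0 : 0 < k by rewrite lt_min mulr_gt0.
exists k => // n M q M0 qPM MR.
pose tL (i : 'I_(tdim n d)) := \sum_k l (tidx i k).
pose g (i : 'I_(tdim n d)) := tL i < n%:R * (t + 2 * de).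
pose b (y : {ffun 'I_n -> X}) := \sum_k H (y k) < n%:R * (t + 4 * de).
pose eta := expR (- (k * n%:R)).
have eta_ge a : n%:R * de <= a -> expR (- (s * a)) <= eta.
  move=> ha; rewrite ler_expR lerN2; apply: (@le_trans _ _ (s * (n%:R * de))).
    by rewrite mulrCA mulrC ler_wpM2l // ge_min lexx.
  by rewrite ler_pM2l.
have qfW (A : 'I_n -> 'M[C]_d) i : (forall k, adj (A k) = A k) ->
    qf (row i (tensmxn (fun=> V))) (tensmxn A) = \prod_k m (A k) (tidx i k).
  by move=> hA; rewrite qf_tens.
have q_dist : is_dist q by case: qPM.
have := @converse_one_shot R {ffun 'I_n -> X} q (tdim n d)
  (fun y => tensmxn (fun k => spectralmx (W (y k))))
  (fun y i => \prod_k eig (W (y k)) (tidx i k))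
  (tensmxn (fun _ => spectralmx rho)) (fun i => \prod_k eig rho (tidx i k))
  (tensmxn (fun _ => V)) g b
  (expR (- (n%:R * (Hrho - 2 * de)))) (expR (- (n%:R * (t + 6 * de)))) eta M.
rewrite -iid_sp; have -> : \sum_y toC (q y) *: sp (tensmxn (fun k => spectralmx (W (y k))))
    (fun i => \prod_k eig (W (y k)) (tidx i k)) = Wnmix W q.
  by apply: eq_bigr => y _; rewrite -Wn_sp.
move=> H1S; apply: le_trans; first apply: H1S.
- exact: q_dist.
- by move=> y; apply: tens_unitary => k'; exact: spectral_unitary.
- by apply: tens_unitary => k'; exact: spectral_unitary.
- by apply: tens_unitary => k'; exact: uV.
- by move=> y; apply: (@tidx_dist n (fun k' => eig (W (y k')))) => k'; exact: wW.
- by apply: (@tidx_dist n (fun=> eig rho)) => k'; exact: wrho.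
- exact: expR_ge0.
- exact: expR_gt0.
- exact: PM_support.
- move=> y nb; rewrite -Wn_sp /Wn.
  under eq_bigr do rewrite (qfW _ _ (fun k => state_adj (sW _))).
  rewrite /g /tL (sum_tidx (fun j : {ffun 'I_n -> 'I_d} => \prod_k m (W (y k)) (j k))
     (fun j : {ffun 'I_n -> 'I_d} => \sum_k l (j k) < n%:R * (t + 2 * de))).
  have c := chernoff (fun k => y k) (- (n%:R * (t + 2 * de))) (fun x j => (mW x).1 j) s0
    (fun x => h1 s x ss1).
  apply: (@le_trans _ _ (expR (- (s * (- (n%:R * (t + 2 * de)) - \sum_k \sum_j m (W (y k)) j * - l j - n%:R * de))))).
    apply: le_trans c; rewrite big_mkcond [leRHS]big_mkcond; apply: ler_sum => j _.
    rewrite sumrN lerN2; case: ifPn => [lt|_].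
      by rewrite (ltW lt).
    by case: ifP => // _; apply: prodr_ge0 => k' _; case: (mW (y k')).
  apply: eta_ge; have : n%:R * (t + 4 * de) <= - \sum_k \sum_j m (W (y k)) j * - l j.
    apply: (@le_trans _ _ (\sum_k H (y k))); first by rewrite leNgt.
    rewrite -sumrN; apply: ler_sum => k' _; apply: (le_trans (HL (y k'))).
    by rewrite -mean -sumrN le_eqVlt; apply/orP; left; apply/eqP; apply: eq_bigr => j _; rewrite mulrN opprK.
  by move: (\sum_k _) => a; lra.
- move=> y by_.
  rewrite (sum_tidx (fun j : {ffun 'I_n -> 'I_d} => \prod_k eig (W (y k)) (j k))
     (fun j : {ffun 'I_n -> 'I_d} => \prod_k eig (W (y k)) (j k) < expR (- (n%:R * (t + 6 * de))))).
  apply: (le_trans (lower_tail wW (fun k => y k) (n%:R * (t + 6 * de)) s0 (fun x => h3 s x ss3))).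
  by apply: eta_ge; move: by_; rewrite /b /H; move: (\sum_k _) => a; lra.
- rewrite Wnmix_iid.
  under eq_bigr do rewrite (qfW _ _ (fun k => state_adj srho)).
  rewrite /g /tL (sum_tidx (fun j : {ffun 'I_n -> 'I_d} => \prod_k m rho (j k))
     (fun j : {ffun 'I_n -> 'I_d} => ~~ (\sum_k l (j k) < n%:R * (t + 2 * de)))).
  under eq_bigl do rewrite -leNgt.
  apply: (le_trans (chernoff (fun _ : 'I_n => tt) (n%:R * (t + 2 * de)) (fun _ j => mrho.1 j) s0
    (fun x => h2 s x ss2))).
  apply: eta_ge; rewrite mean -/t sumr_const card_ord -mulr_natl; lra.
- rewrite (sum_tidx (fun j : {ffun 'I_n -> 'I_d} => \prod_k eig rho (j k))
     (fun j : {ffun 'I_n -> 'I_d} => expR (- (n%:R * (Hrho - 2 * de))) < \prod_k eig rho (j k))).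
  apply: (le_trans (upper_tail (fun _ : unit => wrho) (fun _ : 'I_n => tt) (n%:R * (Hrho - 2 * de)) s0
    (fun x => h4 s x ss4))).
  apply: eta_ge; rewrite sumr_const card_ord -mulr_natl -/Hrho; lra.
rewrite -/eta; suff : expR (- (n%:R * (Hrho - 2 * de))) * M%:R / expR (- (n%:R * (t + 6 * de))) <= eta by lra.
rewrite -expRN opprK; apply: (@le_trans _ _ (expR (- (n%:R * (Hrho - 2 * de))) * expR (n%:R * r) * expR (n%:R * (t + 6 * de)))).
  by rewrite ler_pM2r ?expR_gt0 // ler_pM2l ?expR_gt0.
rewrite -!expRD ler_expR.
have kde : k * n%:R <= de * n%:R by rewrite ler_wpM2r // ge_min lexx orbT.
have -> : - (n%:R * (Hrho - 2 * de)) + n%:R * r + n%:R * (t + 6 * de) =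
   - (n%:R * (Hrho - r - t - 8 * de)) by ring.
by rewrite gap; lra.
Qed.

Lemma achievability_exponent (q : X -> R) (r : R) : is_dist q -> Wmix W q = rho ->
  Hrho - \sum_x q x * H x < r ->
  exists2 k, 0 < k & forall n M, (0 < M)%N -> expR (n%:R * r) <= M%:R ->
    exists2 c : seq {ffun 'I_n -> X}, size c = M &
    trnorm (Wnmix W (@iid R X p n) - toC M%:R^-1 *: \sum_(y <- c) Wn W y) <=
      5 * expR (- (k * n%:R)).
Proof.
move=> q_dist qrho; set h := \sum_x q x * H x => rgt.
(* The cutoff exponents [h - 3 de] and [Hrho + 2 de] use five shares and the factor [th ^+ 2] at
   most one; the rest is spare. *)
pose de := (r - (Hrho - h)) / 7; have de0 : 0 < de by apply: divr_gt0 => //; lra.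
have gap : r = Hrho - h + 7 * de by rewrite /de; field.
have wW x : is_dist (eig (W x)) by exact: eig_dist.
have wrho : is_dist (eig rho) by exact: eig_dist.
have [s1 s10 h1] := mgf_uniform (fun x j => ln (eig (W x) j)) wW de0.
have [s2 s20 h2] := mgf_uniform (fun (_ : unit) j => - ln (eig rho j)) (fun=> wrho) de0.
(* Random words also fluctuate in total entropy, which calls for a third moment bound, over
   letters. *)
have [s3 s30 h3] := mgf_le (fun x => - H x) q_dist de0.
pose s := Num.min s1 (Num.min s2 s3).
have s0 : 0 < s by rewrite !lt_min s10 s20 s30.
have [ss1 ss2 ss3] : [/\ 0 < s <= s1, 0 < s <= s2 & 0 < s <= s3].
  by split; rewrite s0 /s !ge_min lexx ?orbT.
(* Halved because the tails are compared with [th ^+ 2]. *)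
pose k := Num.min (s * de) de / 2.
have k0 : 0 < k by rewrite divr_gt0 // lt_min mulr_gt0.
have k1 : 2 * k <= s * de by rewrite /k mulrCA divff ?mulr1 ?ge_min ?lexx.
have k2 : 2 * k <= de by rewrite /k mulrCA divff ?mulr1 ?ge_min ?lexx ?orbT.
exists k => // n M M0 Mr.
pose th := expR (- (k * n%:R)).
have th2 : th ^+ 2 = expR (- (2 * k * n%:R)) by rewrite -expRM_natl; congr expR; ring.
have th_ge a : n%:R * de <= a -> expR (- (s * a)) <= th ^+ 2.
  move=> ha; rewrite th2 ler_expR lerN2; apply: (@le_trans _ _ (s * (n%:R * de))).
    by have := ler_wpM2r (ler0n R n) k1; lra.
  by rewrite ler_pM2l.
have := @achievability_one_shot R {ffun 'I_n -> X} (@iid R X q n) (tdim n d)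
  (fun y => tensmxn (fun k => spectralmx (W (y k))))
  (fun y i => \prod_k eig (W (y k)) (tidx i k))
  (tensmxn (fun _ => spectralmx rho)) (fun i => \prod_k eig rho (tidx i k))
  (expR (- (n%:R * (h - 3 * de)))) (expR (- (n%:R * (Hrho + 2 * de)))) th M.
have -> : \sum_y toC (@iid R X q n y) *: sp (tensmxn (fun k => spectralmx (W (y k))))
    (fun i => \prod_k eig (W (y k)) (tidx i k)) = Wnmix W (@iid R X p n).
  rewrite Wnmix_iid -/rho -qrho -Wnmix_iid; apply: eq_bigr => y _.
  by rewrite -Wn_sp.
move=> H1S; have [|||||||||||||c sz hc] := H1S.
- exact: (prod_dist (fun=> q_dist)).
- by move=> y; apply: tens_unitary => k'; exact: spectral_unitary.
- by apply: tens_unitary => k'; exact: spectral_unitary.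
- by move=> y; apply: (@tidx_dist n (fun k' => eig (W (y k')))) => k'; exact: wW.
- by apply: (@tidx_dist n (fun=> eig rho)) => k'; exact: wrho.
- exact: iid_sp.
- exact: expR_ge0.
- exact: expR_gt0.
- by rewrite expR_gt0 -expR0 ler_expR oppr_le0 mulr_ge0 // ltW.
- exact: M0.
(* Two layers: the eigenvalue tail for a fixed word, then the average over words of the resulting
   exponential in its total entropy. *)
- apply: (@le_trans _ _ (\sum_y @iid R X q n y *
      expR (- (s * (\sum_k H (y k) - n%:R * (h - 3 * de) - n%:R * de))))).
    apply: ler_sum => y _; apply: ler_wpM2l.
      by apply: prodr_ge0 => k' _; case: q_dist.
    rewrite (sum_tidx (fun j : {ffun 'I_n -> 'I_d} => \prod_k eig (W (y k)) (j k))
     (fun j : {ffun 'I_n -> 'I_d} => expR (- (n%:R * (h - 3 * de))) < \prod_k eig (W (y k)) (j k))).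
    exact: (upper_tail wW (fun k => y k) (n%:R * (h - 3 * de)) s0 (fun x => h1 s x ss1)).
  have -> : \sum_y @iid R X q n y *
      expR (- (s * (\sum_k H (y k) - n%:R * (h - 3 * de) - n%:R * de))) =
    expR (s * (n%:R * (h - 2 * de))) *
      \sum_(y : {ffun 'I_n -> X}) \prod_k (q (y k) * expR (s * - H (y k))).
    rewrite mulr_sumr; apply: eq_bigr => y _.
    rewrite big_split /= -expR_sum -mulr_sumr [RHS]mulrCA -expRD; congr (_ * expR _).
    have -> : \sum_k - H (y k) = - \sum_k H (y k) by rewrite -[RHS]sumrN.
    by move: (\sum_k _) => a; ring.
  rewrite (sum_ffun_prod (fun (_ : 'I_n) x => q x * expR (s * - H x))).
  apply: (@le_trans _ _ (expR (s * (n%:R * (h - 2 * de))) * \prod_(k < n) expR (s * (- h + de)))).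
    apply: ler_wpM2l; first exact: expR_ge0.
    apply: ler_prod => k' _; apply/andP; split.
      by apply: sumr_ge0 => x _; rewrite mulr_ge0 ?expR_ge0 //; case: q_dist.
    apply: (le_trans (h3 s ss3)); rewrite ler_expR ler_pM2l // lerD2r.
    by under eq_bigr do rewrite mulrN; rewrite sumrN.
  rewrite -expR_sum sumr_const card_ord -expRD -(mulr_natl (s * (- h + de))).
  have -> : s * (n%:R * (h - 2 * de)) + n%:R * (s * (- h + de)) = - (s * (n%:R * de)) by ring.
  exact: th_ge.
- rewrite (sum_tidx (fun j : {ffun 'I_n -> 'I_d} => \prod_k eig rho (j k))
     (fun j : {ffun 'I_n -> 'I_d} => \prod_k eig rho (j k) < expR (- (n%:R * (Hrho + 2 * de))))).
  apply: (le_trans (lower_tail (fun _ : unit => wrho) (fun _ : 'I_n => tt) (n%:R * (Hrho + 2 * de)) s0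
    (fun x => h2 s x ss2))).
  apply: th_ge; rewrite sumr_const card_ord -mulr_natl -/Hrho; lra.
- rewrite th2; apply: (@le_trans _ _ (expR (- (2 * k * n%:R)) * expR (n%:R * r) * expR (- (n%:R * (Hrho + 2 * de))))).
    rewrite -!expRD ler_expR gap.
    have : 2 * k * n%:R <= de * n%:R by rewrite ler_wpM2r.
    have : 0 <= de * n%:R by rewrite mulr_ge0 // ltW.
    lra.
  by rewrite ler_pM2r ?expR_gt0 // ler_pM2l ?expR_gt0.
exists c; first exact: sz.
suff -> : \sum_(y <- c) Wn W y = \sum_(y <- c) sp (tensmxn (fun k => spectralmx (W (y k))))
    (fun i => \prod_k eig (W (y k)) (tidx i k)) by exact: hc.
by apply: eq_bigr => y _; exact: Wn_sp.
Qed.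

End Asymptotics.

(** * The optimal rate *)

Section Limits.
Variable R : realType.

Lemma exp_decay_near (a k e : R) : 0 < k -> 0 < e ->
  \forall n \near \oo, a * expR (- (k * n%:R)) <= e.
Proof.
move=> k0 e0; have [a0|a0] := lerP a 0.
  by near=> n; apply: (le_trans _ (ltW e0)); rewrite mulr_le0_ge0 // expR_ge0.
near=> n; have h : ln (a / e) / k <= n%:R by near: n; exact: nbhs_infty_ger.
rewrite -ler_pdivlMl // -[leRHS](lnK (x := a^-1 * e)); last by rewrite posrE mulr_gt0 // invr_gt0.
rewrite ler_expR (_ : a^-1 * e = (a / e)^-1); last by rewrite invf_div mulrC.
rewrite lnV ?posrE ?divr_gt0 // lerN2.
by move: h; rewrite ler_pdivrMr // (mulrC k).
Unshelve. all: by end_near.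
Qed.

Lemma limn_einf_EFin (u : nat -> R) (l : R) :
  (forall e : R, 0 < e -> \forall n \near \oo, l - e <= u n <= l + e) ->
  limn_einf (fun n => (u n)%:E) = l%:E.
Proof.
move=> h; apply: (cvg_limn_einf_sup _).1; apply: cvg_EFin; first by near=> n.
apply/cvgrPdist_le => e e0; have := h e e0; apply: filterS => n /= /andP[h1 h2].
by rewrite ler_norml; apply/andP; split; lra.
Unshelve. all: by end_near.
Qed.

Lemma powR2E (x : R) : 2 `^ x = expR (x * ln 2).
Proof. by rewrite /powR pnatr_eq0. Qed.

Lemma ln2_gt0 : 0 < ln (2 : R).
Proof. by rewrite ln_gt0 // ltr1n. Qed.

(** The gap between the rates eventually gives a factor 2, which covers the loss of less than 1 by
    truncation. [r0] is in nats, [a] in bits. *)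
Lemma truncn_powR2_near (r0 a : R) : 0 <= r0 -> r0 < a * ln 2 ->
  \forall n \near \oo, expR (n%:R * r0) <= (Num.truncn (2 `^ (n%:R * a)))%:R :> R.
Proof.
move=> r00 ra; have k0 : 0 < a * ln 2 - r0 by lra.
near=> n; have h : 2 * expR (- ((a * ln 2 - r0) * n%:R)) <= 1.
  by near: n; exact: exp_decay_near.
have Y : 2 `^ (n%:R * a) = expR (n%:R * r0) * expR ((a * ln 2 - r0) * n%:R).
  by rewrite powR2E -expRD; congr expR; ring.
have := truncnS_gt (2 `^ (n%:R * a)); rewrite -natr1.
have e1 : 1 <= expR (n%:R * r0) by rewrite -expR0 ler_expR mulr_ge0.
have e2 : 2 <= expR ((a * ln 2 - r0) * n%:R).
  by rewrite expRN ler_pdivrMr ?expR_gt0 // mul1r in h.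
have : expR (n%:R * r0) * 2 <= 2 `^ (n%:R * a) by rewrite Y ler_pM2l // expR_gt0.
by move: (2 `^ _) => y; lra.
Unshelve. all: by end_near.
Qed.

End Limits.

(** * Empirical codebooks and the values of the two rates *)

Section Codebooks.
Variables (R : realType) (X : finType) (d : nat) (W : X -> 'M[R[i]]_d) (p : X -> R).
Hypotheses (sW : forall x, is_state (W x)) (p_dist : is_dist p).

Lemma sum_count_mem (V : lmodType R[i]) (Y : finType) (c : seq Y) (F : Y -> V) :
  \sum_y toC (count_mem y c)%:R *: F y = \sum_(y <- c) F y.
Proof.
elim: c => [|z c IH].
  by rewrite big_nil big1 // => y _; rewrite toC0 scale0r.
rewrite big_cons -IH /=.
under eq_bigr do rewrite natrD toCD scalerDl.
rewrite big_split /=; congr (_ + _).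
rewrite (bigD1 z) //= eqxx toC1 scale1r big1 ?addr0 // => y yz.
by rewrite eq_sym (negPf yz) toC0 scale0r.
Qed.

Lemma sum_count_size (Y : finType) (c : seq Y) : \sum_y (count_mem y c)%:R = (size c)%:R :> R.
Proof.
elim: c => [|z c IH]; first by rewrite big1.
rewrite /= -nat1r -IH; under eq_bigr do rewrite natrD.
rewrite big_split /=; congr (_ + _).
rewrite (bigD1 z) //= eqxx big1 ?addr0 // => y yz.
by rewrite eq_sym (negPf yz).
Qed.

Section Empirical.
Variables (n M : nat) (c : seq {ffun 'I_n -> X}).
Hypotheses (M0 : (0 < M)%N) (sz : size c = M).
Let emp (y : {ffun 'I_n -> X}) : R := (count_mem y c)%:R / M%:R.

Lemma PM_empirical : PM M emp.
Proof.
have m0 : (M%:R : R) != 0 by rewrite pnatr_eq0 -lt0n.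
split; [split=> [y|]|].
- by rewrite divr_ge0.
- by rewrite -mulr_suml sum_count_size sz divff.
- by move=> y; exists (count_mem y c); rewrite mulrC divfK.
Qed.

Lemma Wnmix_empirical : Wnmix W emp = toC M%:R^-1 *: \sum_(y <- c) Wn W y.
Proof.
rewrite -sum_count_mem scaler_sumr /Wnmix; apply: eq_bigr => y _.
by rewrite scalerA -toCM mulrC.
Qed.

End Empirical.

Lemma PM_nonempty n M : (0 < M)%N -> exists q : {ffun 'I_n -> X} -> R, PM M q.
Proof.
move=> M0; have [x _] := exists_le_mean (fun=> 0) p_dist.
by eexists; apply: (@PM_empirical n M (nseq M [ffun=> x])) => //; rewrite size_nseq.
Qed.

Lemma epsn_le n M (q : {ffun 'I_n -> X} -> R) : PM M q ->
  epsn W p n M <= trnorm (Wnmix W (@iid R X p n) - Wnmix W q) / 2.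
Proof.
move=> qPM; apply: ge_inf; last by exists q.
by exists 0 => _ [q' _ <-]; rewrite divr_ge0 // trnorm_ge0.
Qed.

(** Positivity of [M] supplies a codebook, so that [inf] is not taken at its default value on the
    empty set. *)
Lemma epsn_ge n M a : (0 < M)%N -> (forall q : {ffun 'I_n -> X} -> R, PM M q ->
  a <= trnorm (Wnmix W (@iid R X p n) - Wnmix W q) / 2) -> a <= epsn W p n M.
Proof.
move=> M0 h; apply: lb_le_inf; last by move=> _ [q qPM <-]; exact: h.
by have [q qPM] := PM_nonempty n M0; eexists; exists q.
Qed.

Lemma epsn_ge0 n M : (0 < M)%N -> 0 <= epsn W p n M.
Proof. by move=> M0; apply: epsn_ge => // q _; rewrite divr_ge0 // trnorm_ge0. Qed.

Lemma epsn_le1 n M : (0 < M)%N -> epsn W p n M <= 1.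
Proof.
move=> M0; have [q qPM] := PM_nonempty n M0; apply: (le_trans (epsn_le qPM)).
rewrite ler_pdivrMr // mul1r.
have [K cK ->] := trnorm_attained (Wnmix W (@iid R X p n) - Wnmix W q).
have cNK := contractiveN cK.
have tW (y : {ffun 'I_n -> X}) K' : contractive K' -> rtr (K' *m Wn W y) <= 1.
  move=> cK'; rewrite (Wn_sp sW).
  have [_ w1] : is_dist (fun i : 'I_(tdim n d) => \prod_k eig (W (y k)) (tidx i k)).
    by apply: (@tidx_dist R d n (fun k => eig (W (y k)))) => k; exact: eig_dist.
  rewrite -[leRHS]w1; apply: rtr_contractive_sp => //.
    by apply: tens_unitary => k; exact: spectral_unitary.
  by move=> i; apply: prodr_ge0 => k _; case: (eig_dist (sW (y k))).
have mixle (f : {ffun 'I_n -> X} -> R) K' : is_dist f -> contractive K' -> rtr (K' *m Wnmix W f) <= 1.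
  move=> [f0 f1] cK'; rewrite -[leRHS]f1 /Wnmix mulmx_sumr rtr_sum; apply: ler_sum => y _.
  by rewrite -scalemxAr rtrZ ler_piMr // tW.
rewrite mulmxBr rtrB.
have h1 : rtr (K *m Wnmix W (@iid R X p n)) <= 1.
  by apply: mixle => //; exact: (prod_dist (fun=> p_dist)).
have h2 : - rtr (K *m Wnmix W q) <= 1.
  by rewrite -rtrN -mulNmx; apply: mixle => //; case: qPM.
by move: (rtr _) (rtr _) h1 h2 => a b; lra.
Qed.

Let H x := entropy (eig (W x)).
Let Hrho := entropy (eig (Wmix W p)).
Let feasible (q : X -> R) := is_dist q /\ Wmix W q = Wmix W p.
Let I (q : X -> R) := (Hrho - \sum_x q x * H x) / ln 2.

Lemma epsn_converse (r : R) : (forall q, feasible q -> r < I q) ->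
  exists2 k : R, 0 < k & forall n M, (0 < M)%N -> M%:R <= expR (n%:R * (r * ln 2)) ->
    1 - epsn W p n M <= 4 * expR (- (k * n%:R)).
Proof.
move=> h; have [|k k0 hk] := @converse_exponent R X d W p sW p_dist (r * ln 2).
  move=> q q_dist qrho; have := h q (conj q_dist qrho).
  by rewrite /I ltr_pdivlMr ?ln2_gt0 //; rewrite -/H -/Hrho; move: (\sum_x _) => a; lra.
exists k => // n M M0 MR; rewrite lerBlDl -lerBlDr; apply: epsn_ge => // q qPM.
by have := hk n M q M0 qPM MR; lra.
Qed.

Lemma epsn_achievability (q : X -> R) (a : R) : feasible q -> I q < a -> 0 <= I q ->
  exists2 k : R, 0 < k & \forall n \near \oo,
    epsn W p n (Num.truncn (2 `^ (n%:R * a))) <= 3 * expR (- (k * n%:R)).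
Proof.
move=> [q_dist qrho] Iqa Iq0; have l2 := ln2_gt0 R.
have Ia : I q * ln 2 < a * ln 2 by rewrite ltr_pM2r.
(* The midpoint leaves room on both sides: below for the exponent, above for the truncation. *)
pose r0 := (I q * ln 2 + a * ln 2) / 2.
have [|k k0 hk] := @achievability_exponent R X d W p sW p_dist q r0 q_dist qrho.
  by rewrite -/H -/Hrho /r0; move: Ia; rewrite /I divfK ?gt_eqF //; lra.
exists k => //.
near=> n.
have tr : expR (n%:R * r0) <= (Num.truncn (2 `^ (n%:R * a)))%:R :> R.
  by near: n; apply: truncn_powR2_near; rewrite /r0 ?divr_ge0 //; nra.
set M := Num.truncn _ in tr *.
have M0 : (0 < M)%N by rewrite -(ltr0n R) (lt_le_trans _ tr) // expR_gt0.
have [c sz hc] := hk n M M0 tr.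
apply: (le_trans (epsn_le (PM_empirical M0 sz))); rewrite Wnmix_empirical.
by move: hc (expR_gt0 (- (k * n%:R))); move: (trnorm _) (expR _) => x y; lra.
Unshelve. all: by end_near.
Qed.

Lemma mutinf_feasible q : feasible q -> mutinf W q = (I q)%:E.
Proof. by move=> [q_dist qrho]; rewrite (mutinfE sW q_dist) qrho. Qed.

Lemma feasible_ge0 q : feasible q -> 0 <= I q.
Proof.
move=> [q_dist qrho]; apply: divr_ge0; last exact: ltW (ln2_gt0 R).
by rewrite subr_ge0 /Hrho -qrho; exact: entropy_concave.
Qed.

(** Feasibility of [p] bounds the infimum above and concavity of entropy bounds it below, so it is a
    real number, approached by feasible [q]. *)
Lemma Iinf_fin : exists J : R, [/\ Iinf W p = J%:E, 0 <= J,
  (forall q, feasible q -> J <= I q) & (forall a, J < a -> exists2 q, feasible q & I q < a)].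
Proof.
have fp : feasible p by [].
have Ile : (Iinf W p <= (I p)%:E)%E.
  by rewrite -mutinf_feasible //; apply: ereal_inf_lbound; exists p.
have Ige : (0%:E <= Iinf W p)%E.
  apply: le_ereal_inf_tmp => _ [q fq <-]; rewrite mutinf_feasible // lee_fin.
  exact: feasible_ge0.
have [J EJ] : exists J, Iinf W p = J%:E.
  move: Ile Ige; case: (Iinf W p) => [J _ _|//|//]; by exists J.
exists J; split => //.
- by rewrite -lee_fin -EJ.
- move=> q fq; rewrite -lee_fin -EJ -mutinf_feasible //.
  by apply: ereal_inf_lbound; exists q.
- move=> a Ja; have : (Iinf W p < a%:E)%E by rewrite EJ lte_fin.
  move=> /ereal_inf_lt [_ [q fq <-]]; rewrite mutinf_feasible // lte_fin => h.
  by exists q.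
Qed.

Section WithValue.
Variable J : R.
Hypotheses (J0 : 0 <= J) (J_lb : forall q, feasible q -> J <= I q)
  (J_inf : forall a, J < a -> exists2 q, feasible q & I q < a).

Lemma truncn_powR2_gt0 n (a : R) : 0 <= a -> (0 < Num.truncn (2 `^ (n%:R * a) : R))%N.
Proof.
move=> a0; rewrite truncn_gt0 powR2E -[leLHS]expR0 ler_expR !mulr_ge0 //.
exact: ltW (ln2_gt0 R).
Qed.

Lemma epsn_above (a : R) : J < a -> exists2 k : R, 0 < k & \forall n \near \oo,
  epsn W p n (Num.truncn (2 `^ (n%:R * a))) <= 3 * expR (- (k * n%:R)).
Proof.
move=> /J_inf [q fq Iqa]; exact: (epsn_achievability fq Iqa (feasible_ge0 fq)).
Qed.

Lemma epsn_below (r : R) : r < J -> exists2 k : R, 0 < k &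
  forall n M, (0 < M)%N -> M%:R <= expR (n%:R * (r * ln 2)) ->
    1 - epsn W p n M <= 4 * expR (- (k * n%:R)).
Proof.
by move=> rJ; apply: epsn_converse => q fq; apply: (lt_le_trans rJ); exact: J_lb.
Qed.

Lemma epsn_below_truncn (r : R) : 0 <= r -> r < J -> exists2 k : R, 0 < k &
  forall n, 1 - epsn W p n (Num.truncn (2 `^ (n%:R * r))) <= 4 * expR (- (k * n%:R)).
Proof.
move=> r0 /epsn_below [k k0 hk]; exists k => // n; apply: hk.
  exact: truncn_powR2_gt0.
by rewrite mulrA -powR2E truncn_le powR_ge0.
Qed.

Lemma Rsoft_value : Rsoft W p = J%:E.
Proof.
apply/eqP; rewrite eq_le; apply/andP; split.
  apply/lee_addgt0Pr => e e0; rewrite -EFinD; apply: ereal_inf_lbound.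
  (* The offset [e] keeps the rate positive even when [J] is 0. *)
  exists (J + e) => //; split; first by rewrite ltr_wpDl.
  move=> g g0; apply: limn_einf_EFin => e' e'0.
  have [|k k0 hk] := @epsn_above (J + e + g); first by rewrite -addrA ltrDl addr_gt0.
  near=> n; rewrite !add0r; apply/andP; split.
    apply: (@le_trans _ _ 0); first by rewrite oppr_le0 ltW.
    by apply/epsn_ge0/truncn_powR2_gt0; rewrite !addr_ge0 // ltW.
  apply: (@le_trans _ _ (3 * expR (- (k * n%:R)))); first by near: n.
  by near: n; exact: exp_decay_near.
apply: le_ereal_inf_tmp => _ [r [r0 hr] <-]; rewrite lee_fin leNgt; apply/negP => rJ.
(* Since [r + g] is still below [J], the error at that rate tends to 1 and its lower limit cannot be
   0. *)
pose g := (J - r) / 2; have g0 : 0 < g by rewrite divr_gt0 // subr_gt0.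
have rgJ : r + g < J by rewrite /g; lra.
have [|k k0 hk] := epsn_below_truncn _ rgJ; first by lra.
suff : limn_einf (fun n => (epsn W p n (Num.truncn (2 `^ (n%:R * (r + g)))))%:E) = 1%:E.
  by rewrite hr // => -[] /eqP; rewrite eq_sym oner_eq0.
apply: limn_einf_EFin => e e0; near=> n; apply/andP; split; last first.
  apply: (@le_trans _ _ 1); last by lra.
  by apply/epsn_le1/truncn_powR2_gt0; lra.
have := hk n; have : 4 * expR (- (k * n%:R)) <= e by near: n; exact: exp_decay_near.
lra.
Unshelve. all: by end_near.
Qed.

Lemma Reps_value (e : R) : 0 < e < 1 -> Reps W p e = J%:E.
Proof.
move=> /andP[e0 e1]; apply: limn_einf_EFin => e' e'0.
have [|k k0 hk] := @epsn_above (J + e'); first by lra.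
(* [J - e'] may be negative, so the form with a general size [M] is used rather than a truncated
   power. *)
have [|k' k'0 hk'] := @epsn_below (J - e'); first by lra.
have l2 := ln2_gt0 R.
near=> n; have n0 : (0 < n)%N by near: n; exists 1%N.
have hkn : epsn W p n (Num.truncn (2 `^ (n%:R * (J + e')))) <= 3 * expR (- (k * n%:R)).
  by near: n; exact: hk.
have nR : (0 : R) < n%:R by rewrite ltr0n.
set M := Num.truncn (2 `^ (n%:R * (J + e')) : R).
have M0 : (0 < M)%N by apply: truncn_powR2_gt0; rewrite addr_ge0 // ltW.
have MS : Mset W p e n M.
  rewrite /Mset M0 /=; apply/asboolP.
  by apply: (le_trans hkn); near: n; exact: exp_decay_near.
rewrite /Meps; case: pselect => [ex|]; last by move=> []; exists M.
case: ex_minnP => m /andP[m0 /asboolP me] mmin.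
have mR : (0 : R) < m%:R by rewrite ltr0n.
rewrite ler_pdivlMr // ler_pdivrMr // /log2 ler_pdivlMr // ler_pdivrMr //; apply/andP; split.
  rewrite leNgt; apply/negP => lt.
  have mle : m%:R <= expR (n%:R * ((J - e') * ln 2)).
    by rewrite -[leLHS](lnK (x := m%:R)) ?posrE // ler_expR; move: lt; lra.
  have := hk' n m m0 mle.
  (* This pushes the error up to at least [(1 + e) / 2], beyond the allowed [e]. *)
  have : 4 * expR (- (k' * n%:R)) <= (1 - e) / 2 by near: n; apply: exp_decay_near; lra.
  lra.
rewrite -ler_expR lnK ?posrE //; apply: (@le_trans _ _ M%:R); first by rewrite ler_nat mmin.
have -> : (J + e') * n%:R * ln 2 = n%:R * (J + e') * ln 2 by ring.
by rewrite -powR2E truncn_le powR_ge0.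
Unshelve. all: by end_near.
Qed.

End WithValue.

End Codebooks.

Theorem theorem2 (R : realType) (X : finType) (d : nat)
    (W : X -> 'M[R[i]]_d) (p : X -> R) :
  (forall x, is_state (W x)) -> is_dist p ->
  (forall e : R, 0 < e < 1 ->
     Rsoft W p = Reps W p e /\ Reps W p e = Iinf W p) /\
  (forall r : R, 0 <= r -> (r%:E < Rsoft W p)%E ->
     exists c : R, 0 < c /\
       \forall n \near \oo,
         1 - epsn W p n (Num.truncn (2 `^ (n%:R * r))) <= 2 `^ (- (c * n%:R))).
Proof.
move=> sW p_dist; have [J [EJ J0 Jlb Jinf]] := Iinf_fin sW p_dist.
have ER := Rsoft_value sW p_dist J0 Jlb Jinf.
split=> [e e01|r r0]; first by rewrite ER EJ (Reps_value sW p_dist J0 Jlb Jinf e01).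
rewrite ER lte_fin => rJ; have [k k0 hk] := epsn_below_truncn sW p_dist Jlb r0 rJ.
(* Half of the exponent absorbs the factor 4 for large [n]; [ln 2] changes the base. *)
have l2 := ln2_gt0 R; exists (k / 2 / ln 2); split; first by rewrite !divr_gt0.
near=> n; apply: (le_trans (hk n)).
have -> : 2 `^ (- (k / 2 / ln 2 * n%:R)) = expR (- (k / 2 * n%:R)).
  by rewrite powR2E mulNr; congr (expR (- _)); field; rewrite gt_eqF.
have -> : 4 * expR (- (k * n%:R)) = 4 * expR (- (k / 2 * n%:R)) * expR (- (k / 2 * n%:R)).
  by rewrite -mulrA -expRD; congr (_ * expR _); field.
rewrite ler_piMl ?expR_ge0 //; near: n; apply: exp_decay_near => //.
exact: divr_gt0.
Unshelve. all: by end_near.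
Qed.
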